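(* Let $q\in(-1,1)$, $q\neq0$, $A_q=C(SU_q(2))$, and let $\widehat{A_q}$ be the $C^*$-algebra (a $c_0$-direct sum of matrix algebras) associated with the dual quantum group $\widehat{SU_q(2)}$. Let $w_\lambda$ and $w_\pi$ be the unitary co-representations of $\widehat{SU_q(2)}$ (with its opposite coproduct) corresponding to the representations $U\lambda_q(\cdot)U^*$ and $I\otimes\pi_q(\cdot)$ of $A_q$ on $\ell^2(\mathbb{N})\otimes\mathcal{H}_\pi$, as described in the context; they are unitary elements of $M(\widehat{A_q}\otimes\mathcal{K}(\ell^2(\mathbb{N})\otimes\mathcal{H}_\pi))$. Then $$w_\lambda-w_\pi\in\widehat{A_q}\otimes\mathcal{K}(\mathscr{T}\otimes\mathcal{H}_\pi),$$ where $\mathscr{T}$ is the Toeplitz algebra and $\mathcal{K}(\mathscr{T}\otimes\mathcal{H}_\pi)\cong\mathscr{T}\otimes\mathcal{K}(\mathcal{H}_\pi)$ is the space of compact operators on the Hilbert $\mathscr{T}$-module $\mathscr{T}\otimes\mathcal{H}_\pi$. Thus $(w_\lambda,w_\pi,I)$ gives a Fredholm representation of the dual $\widehat{SU_q(2)}$ with coefficients in the Toeplitz algebra $\mathscr{T}$.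
   Context: $\mathbb{N}=\{0,1,2,\ldots\}$; $\mathcal{L}$ and $\mathcal{K}$ denote bounded (adjointable) and compact operators on a Hilbert space (Hilbert $C^*$-module), and $M(\cdot)$ the multiplier algebra. $\mathscr{T}$ is the Toeplitz algebra, the $C^*$-algebra on $\ell^2(\mathbb{N})$ generated by the unilateral shift. One has $\mathscr{T}\otimes\mathcal{K}(\mathcal{H}_\pi)\cong\mathcal{K}(\mathscr{T}\otimes\mathcal{H}_\pi)$ and $M(\mathscr{T}\otimes\mathcal{K}(\mathcal{H}_\pi))\cong\mathcal{L}(\mathscr{T}\otimes\mathcal{H}_\pi)$. $A_q=C(SU_q(2))$ is the $C^*$-algebra generated by $\alpha_q,\beta_q$ (written $\alpha,\beta$ here) satisfying $$\alpha^*\alpha+\beta^*\beta=I,\quad \alpha\alpha^*+q^2\beta\beta^*=I,\quad \alpha\beta=q\beta\alpha,\quad \alpha\beta^*=q\beta^*\alpha,\quad \beta^*\beta=\beta\beta^*,$$ with coproduct $\Delta(\alpha)=\alpha\otimes\alpha-q\beta^*\otimes\beta$, $\Delta(\beta)=\beta\otimes\alpha+\alpha^*\otimes\beta$. Dual quantum group: for a compact quantum group $G$ with $A=C(G)$, let $u^{(\gamma)}\in\mathcal{L}(\mathcal{H}_\gamma)\otimes A$ run over representatives of the equivalence classes $\gamma$ of irreducible unitary representations of $G$, with $\mathcal{H}_\gamma$ finite dimensional. Let $\hat A$ be the $c_0$-direct sum $\oplus_\gamma\mathcal{L}(\mathcal{H}_\gamma)$ and $u=\oplus_\gamma u^{(\gamma)}$,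 a unitary in $M(\hat A\otimes A)$ satisfying $(id\otimes\Delta_G)u=u_{1,2}u_{1,3}$ and $(\Delta_{\hat G}\otimes id)u=u_{2,3}u_{1,3}$. For a representation $\rho$ of $A$ on a Hilbert space $\mathcal{H}$, put $w_\rho=(id\otimes\rho)u$. It is a unitary element of $M(\hat A\otimes\mathcal{K}(\mathcal{H}))$ satisfying $(\Delta_{\hat G}\otimes id)w_\rho=(w_\rho)_{2,3}(w_\rho)_{1,3}$, called the co-representation of $\hat G$ corresponding to $\rho$. Here $w_\lambda$ and $w_\pi$ are $w_\rho$ for $\rho=U\lambda_q(\cdot)U^*$ and $\rho=I\otimes\pi_q(\cdot)$ respectively. Fredholm representation with coefficients: for a discrete group $\Gamma'$, a Fredholm representation (Mishchenko) is a pair of unitary representations $\pi_1,\pi_2$ on a Hilbert space $\mathcal{H}$ and a Fredholm operator $F\in\mathcal{L}(\mathcal{H})$ with $F\pi_1(g)-\pi_2(g)F\in\mathcal{K}(\mathcal{H})$ for all $g\in\Gamma'$. For a discrete quantum group with $C^*$-algebra $\hat A$, $\pi_1,\pi_2$ are unitary representations in $M(\hat A\otimes\mathcal{K}(\mathcal{H}))$ and the condition becomes $(I\otimes F)\pi_1-\pi_2(I\otimes F)\in\hat A\otimes\mathcal{K}(\mathcal{H})$. With coefficients: assume $\mathcal{H}=\mathcal{H}_1\otimes\mathcal{H}_2$ and that $B$ is a $C^*$-subalgebra of $\mathcal{L}(\mathcal{H}_1)$ with $\pi_1,\pi_2\in M(\hat A\otimes B\otimes\mathcal{K}(\mathcal{H}_2))$.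 Then $(\pi_1,\pi_2,F)$ is called a Fredholm representation with coefficients in $B$ if $$(I\otimes F)\pi_1-\pi_2(I\otimes F)\in\hat A\otimes\mathcal{K}(B\otimes\mathcal{H}_2),$$ where $B\otimes\mathcal{H}_2$ denotes the standard Hilbert $B$-module $\ell^2(B)$. Here $\mathcal{H}_1=\ell^2(\mathbb{N})$, $\mathcal{H}_2=\mathcal{H}_\pi$, $B=\mathscr{T}$, $F=I$. Representation $\pi_q$ on $\mathcal{H}_\pi=\ell^2(\mathbb{N})\otimes\ell^2(\mathbb{Z})$: $\pi_q(\alpha_q)=S\sqrt{I-q^{2N}}\otimes I$ and $\pi_q(\beta_q)=q^N\otimes S$. Here on $\ell^2(\mathbb{N})$, $Ne_k=ke_k$ and $S$ is the left shift ($Se_k=e_{k-1}$ for $k\ge1$, $Se_0=0$), while on $\ell^2(\mathbb{Z})$, $S$ denotes $e_k\mapsto e_{k-1}$. The GNS space $L^2(SU_q(2))$ of the Haar state is identified with $\ell^2(\Gamma)$, $\Gamma=\{(n,i,j): n\in\frac12\mathbb{N},\ i,j\in\{-n,-n+1,\ldots,n\}\}$, through the orthonormal basis $e^n_{ij}$ of normalized matrix entries of the irreducible unitary (co-)representations of $SU_q(2)$. In this basis the GNS representation (left multiplication) $\lambda_q$ is given by $$\lambda_q(\alpha_q)e^n_{ij}=a_+(n,i,j)e^{n+\frac12}_{i-\frac12,j-\frac12}+a_-(n,i,j)e^{n-\frac12}_{i-\frac12,j-\frac12},$$ $$\lambda_q(\beta_q)e^n_{ij}=b_+(n,i,j)e^{n+\frac12}_{i+\frac12,j-\frac12}+b_-(n,i,j)e^{n-\frac12}_{i+\frac12,j-\frac12},$$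 where, with $g(k)=(1-q^{2k})^{1/2}$, $$a_+(n,i,j)=q^{2n+i+j+1}\frac{g(n-j+1)g(n-i+1)}{g(2n+1)g(2n+2)},\qquad a_-(n,i,j)=\frac{g(n+j)g(n+i)}{g(2n)g(2n+1)},$$ $$b_+(n,i,j)=-q^{n+j}\frac{g(n-j+1)g(n+i+1)}{g(2n+1)g(2n+2)},\qquad b_-(n,i,j)=q^{n+i}\frac{g(n+j)g(n-i)}{g(2n)g(2n+1)}.$$ For $n=0$, $a_-$ and $b_-$ are taken to be $0$. Terms whose basis vector index lies outside $\Gamma$ have coefficient $0$. With $e(r,s,t)=e_r\otimes e_s\otimes e_t$ ($r,s\in\mathbb{N}$, $t\in\mathbb{Z}$) the canonical basis of $\ell^2(\mathbb{N})\otimes\mathcal{H}_\pi$, the unitary $U:\ell^2(\Gamma)\to\ell^2(\mathbb{N})\otimes\mathcal{H}_\pi$ is $$Ue^n_{ij}=(-1)^{\max(i,j)-j}\,e\bigl(n-\max(i,j),\,n+\min(i,j),\,j-i\bigr).$$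
   Formalization: Membership in Â_q⊗K(T⊗H_π), also in the Fredholm condition, is read as: bounded, and in Â_q⊗K(T⊗H_π) after multiplying by a⊗1 on either side, a∈Â_q. Literal c_0 membership fails: the blocks of w_λ−w_π do not tend to 0 in norm (entries (α* )^m). *)

(* Defs.v *)
From HB Require Import structures.
From mathcomp Require Import all_boot all_order all_algebra.
From mathcomp Require Import complex.
From mathcomp Require Import boolp classical_sets functions fsbigop reals.
From mathcomp Require Import constructive_ereal ereal esum.
From mathcomp Require Import ring lra.
Set Implicit Arguments.
Unset Strict Implicit.
Unset Printing Implicit Defensive.
Import Order.TTheory GRing.Theory Num.Theory.
Local Open Scope classical_set_scope.
Local Open Scope ring_scope.

Section RealSums.
Variable R : realType.
Implicit Types X Y : choiceType.

Definition esumR X (h : X -> R) : \bar R := \esum_(x in setT) (h x)%:E.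

Definition summ X (h : X -> R) : Prop := (esumR (fun x => `|h x|%R) < +oo)%E.

(* The sum of an absolutely summable family of reals. *)
Definition rsum X (h : X -> R) : R :=
  fine (esumR (fun x => Num.max (h x) 0))
  - fine (esumR (fun x => Num.max (- h x) 0)).

Lemma esumR_ge0 X (h : X -> R) : (forall x, 0 <= h x) -> (0 <= esumR h)%E.
Proof. by move=> h0; apply: esum_ge0 => x _; rewrite lee_fin. Qed.

Lemma le_esumR X (f g : X -> R) :
  (forall x, f x <= g x) -> (esumR f <= esumR g)%E.
Proof. by move=> fg; apply: le_esum => x _; rewrite lee_fin. Qed.

Lemma esumRD X (f g : X -> R) : (forall x, 0 <= f x) -> (forall x, 0 <= g x) ->
  esumR (fun x => f x + g x) = (esumR f + esumR g)%E.
Proof.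
move=> f0 g0; rewrite /esumR -esumD => [|x _|x _]; rewrite ?lee_fin//.
Qed.

Lemma le_esumRZ X (k : R) (f : X -> R) : 0 <= k -> (forall x, 0 <= f x) ->
  (esumR (fun x => (k * f x)%R) <= k%:E * esumR f)%E.
Proof.
move=> k0 f0; apply: ge_ereal_sup => _ [F FF <-].
have [finF _] := FF.
rewrite fsbig_finite//=.
under eq_bigr do rewrite EFinM.
rewrite -ge0_sume_distrr; last by move=> i _; rewrite lee_fin.
rewrite -fsbig_finite//; apply: lee_wpmul2l; first by rewrite lee_fin.
by apply: ereal_sup_ubound; exists F.
Qed.

Lemma summ_le X (f g : X -> R) : (forall x, `|f x| <= g x) ->
  (esumR g < +oo)%E -> summ f.
Proof. by move=> fg; apply: le_lt_trans; exact: le_esumR. Qed.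

Lemma summ_ge0 X (f : X -> R) : (forall x, 0 <= f x) ->
  summ f <-> (esumR f < +oo)%E.
Proof.
by move=> f0; rewrite /summ (_ : (fun x => `|f x|) = f)//; apply/funext => x;
  rewrite ger0_norm.
Qed.

Lemma fin_esumR X (f : X -> R) : (forall x, 0 <= f x) -> (esumR f < +oo)%E ->
  esumR f \is a fin_num.
Proof. by move=> f0 foo; rewrite ge0_fin_numE// esumR_ge0. Qed.

Lemma summD X (f g : X -> R) : summ f -> summ g -> summ (fun x => f x + g x).
Proof.
move=> sf sg; apply: (@summ_le _ _ (fun x => `|f x| + `|g x|)).
  by move=> x; exact: ler_normD.
by rewrite esumRD// lte_add_pinfty.
Qed.

Lemma summZ X (k : R) (f : X -> R) : summ f -> summ (fun x => k * f x).
Proof.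
move=> sf; apply: (@summ_le _ _ (fun x => `|k| * `|f x|)).
  by move=> x; rewrite normrM.
apply: le_lt_trans (le_esumRZ _ _) _ => //.
by rewrite lte_mul_pinfty ?lee_fin.
Qed.

Lemma summN X (f : X -> R) : summ f -> summ (fun x => - f x).
Proof.
by move=> sf; apply: (@summ_le _ _ (fun x => `|f x|)) => // x; rewrite normrN.
Qed.

Lemma summB X (f g : X -> R) : summ f -> summ g -> summ (fun x => f x - g x).
Proof. by move=> sf sg; exact: (summD sf (summN sg)). Qed.

Lemma rsumE X (f g : X -> R) : (forall x, 0 <= f x) -> (forall x, 0 <= g x) ->
  summ f -> summ g ->
  rsum (fun x => f x - g x) = fine (esumR f) - fine (esumR g).
Proof.
move=> f0 g0 /(summ_ge0 f0) sf /(summ_ge0 g0) sg; rewrite /rsum.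
set p := fun x => Num.max (f x - g x) 0.
set n := fun x => Num.max (- (f x - g x)) 0.
have p0 x : 0 <= p x by rewrite /p le_max lexx orbT.
have n0 x : 0 <= n x by rewrite /n le_max lexx orbT.
have pf x : p x <= f x by rewrite /p ge_max f0 gerBl g0.
have ng x : n x <= g x by rewrite /n opprB ge_max g0 gerBl f0.
have sp : esumR p \is a fin_num.
  by apply: fin_esumR => //; apply: le_lt_trans sf; exact: le_esumR.
have sn : esumR n \is a fin_num.
  by apply: fin_esumR => //; apply: le_lt_trans sg; exact: le_esumR.
have : (esumR p + esumR g = esumR f + esumR n)%E.
  rewrite -!esumRD//; congr esumR; apply/funext => x; rewrite /p /n.
  by rewrite /Num.max; case: ltP => ?; case: ltP => ?; lra.
have Ff := fin_esumR f0 sf; have Fg := fin_esumR g0 sg.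
rewrite -(fineK sp) -(fineK sn) -(fineK Ff) -(fineK Fg) -!EFinD => -[] /=.
lra.
Qed.

Definition rpos X (f : X -> R) x := Num.max (f x) 0.
Definition rneg X (f : X -> R) x := Num.max (- f x) 0.
Lemma rpos_ge0 X (f : X -> R) x : 0 <= rpos f x.
Proof. by rewrite le_max lexx orbT. Qed.
Lemma rneg_ge0 X (f : X -> R) x : 0 <= rneg f x.
Proof. by rewrite le_max lexx orbT. Qed.
Lemma rposneg X (f : X -> R) x : f x = rpos f x - rneg f x.
Proof. by rewrite /rpos /rneg /Num.max; case: ltP => ?; case: ltP => ?; lra. Qed.
Lemma rposle X (f : X -> R) x : rpos f x <= `|f x|.
Proof. by rewrite ge_max ler_norm normr_ge0. Qed.
Lemma rnegle X (f : X -> R) x : rneg f x <= `|f x|.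
Proof. by rewrite ge_max normr_ge0 -normrN ler_norm. Qed.
Lemma summ_rpos X (f : X -> R) : summ f -> summ (rpos f).
Proof.
by move=> sf; apply: summ_le sf => x; rewrite ger0_norm ?rpos_ge0// rposle.
Qed.
Lemma summ_rneg X (f : X -> R) : summ f -> summ (rneg f).
Proof.
by move=> sf; apply: summ_le sf => x; rewrite ger0_norm ?rneg_ge0// rnegle.
Qed.

Lemma rsum0 X : rsum (fun _ : X => 0) = 0.
Proof. by rewrite /rsum oppr0 subrr. Qed.

Lemma rsum_ge0E X (f : X -> R) : (forall x, 0 <= f x) -> rsum f = fine (esumR f).
Proof.
move=> f0; rewrite /rsum.
rewrite (_ : (fun x => Num.max (f x) 0) = f); last first.
  by apply/funext => x; apply/max_idPl.
rewrite (_ : (fun x => Num.max (- f x) 0) = (fun=> 0)); last first.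
  by apply/funext => x; apply/max_idPr; rewrite oppr_le0.
by rewrite [X in _ - fine X]/esumR esum1// subr0.
Qed.

Lemma fine_esumRD X (f g : X -> R) : (forall x, 0 <= f x) ->
  (forall x, 0 <= g x) -> summ f -> summ g ->
  fine (esumR (fun x => f x + g x)) = fine (esumR f) + fine (esumR g).
Proof.
move=> f0 g0 /(summ_ge0 f0) sf /(summ_ge0 g0) sg.
by rewrite esumRD// fineD//; exact: fin_esumR.
Qed.

Lemma rsumD X (f g : X -> R) : summ f -> summ g ->
  rsum (fun x => f x + g x) = rsum f + rsum g.
Proof.
move=> sf sg.
rewrite (_ : (fun x => f x + g x) = (fun x => (rpos f x + rpos g x)
   - (rneg f x + rneg g x))); last first.
  by apply/funext => x; rewrite {1}(rposneg f x) {1}(rposneg g x); lra.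
have P := rpos_ge0; have N := rneg_ge0.
have [sfp sfn] := (summ_rpos sf, summ_rneg sf).
have [sgp sgn] := (summ_rpos sg, summ_rneg sg).
rewrite (rsumE (f := fun x => rpos f x + rpos g x)
               (g := fun x => rneg f x + rneg g x)).
- rewrite (fine_esumRD (P _ f) (P _ g) sfp sgp).
  rewrite (fine_esumRD (N _ f) (N _ g) sfn sgn) /rsum.
  by rewrite -!/(rpos f) -!/(rpos g) -!/(rneg f) -!/(rneg g) opprD addrACA.
- by move=> x; exact: addr_ge0.
- by move=> x; exact: addr_ge0.
- exact: summD.
- exact: summD.
Qed.

Lemma rsumN X (f : X -> R) : rsum (fun x => - f x) = - rsum f.
Proof.
by rewrite /rsum opprB; congr (_ - fine (esumR _)); apply/funext => x;
  rewrite opprK.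
Qed.

Lemma esumRZ X (k : R) (f : X -> R) : 0 <= k -> (forall x, 0 <= f x) ->
  esumR (fun x => k * f x) = (k%:E * esumR f)%E.
Proof.
move=> k0 f0; apply/eqP; rewrite eq_le le_esumRZ//=.
have [k1|{}k0] : 0 = k \/ 0 < k.
  by move: k0; rewrite le_eqVlt => /orP [/eqP ->|]; [left|right].
  rewrite -k1.
  by rewrite mul0e esumR_ge0// => x; rewrite mul0r.
rewrite -lee_pdivlMl//.
rewrite [X in (X <= _)%E](_ : _ = esumR (fun x => k^-1 * (k * f x))).
  apply: le_esumRZ; first by rewrite invr_ge0 ltW.
  by move=> x; apply: mulr_ge0 => //; exact: ltW.
by congr esumR; apply/funext => x; rewrite mulKf// gt_eqF.
Qed.

Lemma rsumZ X (k : R) (f : X -> R) : summ f ->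
  rsum (fun x => k * f x) = k * rsum f.
Proof.
wlog k0 : k / 0 <= k => [H sf|sf].
  have [k0|k0] := leP 0 k; first exact: H.
  have := H (- k); rewrite oppr_ge0 (ltW k0) => /(_ isT sf).
  rewrite (_ : (fun x => - k * f x) = (fun x => - (k * f x))); last first.
    by apply/funext => x; rewrite mulNr.
  by rewrite rsumN mulNr => /oppr_inj.
have P := rpos_ge0; have N := rneg_ge0.
have [sfp sfn] := (summ_rpos sf, summ_rneg sf).
rewrite (_ : (fun x => k * f x) = (fun x => (k * rpos f x) - (k * rneg f x)));
  last by apply/funext => x; rewrite {1}(rposneg f x) mulrBr.
rewrite rsumE; [|by move=> x; exact: mulr_ge0..|exact: summZ|exact: summZ].
rewrite !esumRZ// !fineM// ?fin_esumR// -?summ_ge0//.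
by rewrite -mulrBr.
Qed.

Lemma esumR_pair X Y (f : X * Y -> R) : (forall x, 0 <= f x) ->
  esumR f = \esum_(x in setT) esumR (fun y => f (x, y)).
Proof.
move=> f0; rewrite /esumR (@esum_esum _ _ _ setT (fun=> setT)
  (fun x y => (f (x, y))%:E)); last by move=> x y _ _; rewrite lee_fin.
rewrite (_ : _ `*`` _ = setT); last by apply/seteqP; split=> // -[x y].
by apply: eq_esum => -[].
Qed.

Lemma summ_row X Y (f : X * Y -> R) x : summ f -> summ (fun y => f (x, y)).
Proof.
rewrite /summ (esumR_pair (f := fun p => `|f p|))//.
set G := fun x : X => esumR (fun y => `|f (x, y)|%R).
have G0 z : (0 <= G z)%E by exact: esumR_ge0.
move=> H; apply: (@le_lt_trans _ _ (\esum_(z in setT) G z)) => //.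
rewrite (esumID [set x])// setTI esum_set1//; apply: leeDl.
by apply: esum_ge0.
Qed.

Lemma esumR_fine_row X Y (f : X * Y -> R) : (forall x, 0 <= f x) -> summ f ->
  esumR f = esumR (fun x => fine (esumR (fun y => f (x, y)))).
Proof.
move=> f0 sf; rewrite esumR_pair//; apply: eq_esum => x _.
by rewrite fineK// fin_esumR// -summ_ge0//; exact: (@summ_row _ _ f).
Qed.

Lemma summ_fine_row X Y (f : X * Y -> R) : (forall x, 0 <= f x) -> summ f ->
  summ (fun x => fine (esumR (fun y => f (x, y)))).
Proof.
move=> f0 sf; apply/summ_ge0; last by rewrite -esumR_fine_row// -summ_ge0.
by move=> x; rewrite fine_ge0// esumR_ge0.
Qed.

Lemma rsum_row X Y (f : X * Y -> R) x :
  rsum (fun y => f (x, y)) = fine (esumR (fun y => rpos f (x, y)))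
                             - fine (esumR (fun y => rneg f (x, y))).
Proof. by []. Qed.

Lemma rsum_pair X Y (f : X * Y -> R) : summ f ->
  rsum f = rsum (fun x => rsum (fun y => f (x, y))).
Proof.
move=> sf; have P := rpos_ge0; have N := rneg_ge0.
have [sfp sfn] := (summ_rpos sf, summ_rneg sf).
have -> : (fun x => rsum (fun y => f (x, y))) = (fun x =>
    fine (esumR (fun y => rpos f (x, y))) - fine (esumR (fun y => rneg f (x, y)))).
  by apply/funext => x; exact: rsum_row.
rewrite rsumE.
- by rewrite -!esumR_fine_row.
- by move=> x; rewrite fine_ge0// esumR_ge0.
- by move=> x; rewrite fine_ge0// esumR_ge0.
- exact: summ_fine_row.
- exact: summ_fine_row.
Qed.

Lemma esumR_reindex X Y (e : X -> Y) (f : Y -> R) : bijective e ->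
  esumR f = esumR (fun x => f (e x)).
Proof.
move=> be; rewrite /esumR; apply: reindex_esum.
by rewrite setTT_bijective.
Qed.

Lemma rsum_reindex X Y (e : X -> Y) (f : Y -> R) : bijective e ->
  rsum f = rsum (fun x => f (e x)).
Proof.
by move=> be; rewrite /rsum (esumR_reindex _ be)
  (esumR_reindex (fun x => Num.max (- f x) 0) be).
Qed.

End RealSums.

Section Ell2.
Variable R : realType.
Local Notation C := R[i].
Implicit Types X Y : choiceType.

Definition csummable X (h : X -> C) : Prop :=
  summ (fun x => complex.Re (h x)) /\ summ (fun x => complex.Im (h x)).

Definition csum X (h : X -> C) : C :=
  Complex (rsum (fun x => complex.Re (h x))) (rsum (fun x => complex.Im (h x))).

Definition normsq (z : C) : R := complex.Re z ^+ 2 + complex.Im z ^+ 2.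

Lemma normsq_ge0 z : 0 <= normsq z.
Proof. by rewrite addr_ge0// sqr_ge0. Qed.

Lemma normsq_eq0 z : normsq z = 0 -> z = 0.
Proof.
move: z => [a b] /eqP; rewrite /normsq /= paddr_eq0 ?sqr_ge0// !sqrf_eq0.
by move=> /andP[/eqP -> /eqP ->].
Qed.

Lemma normsqM z w : normsq (z * w) = normsq z * normsq w.
Proof. by move: z w => [a b] [c d]; rewrite /normsq /=; ring. Qed.

Lemma normsqD z w : normsq (z + w) <= 2 * (normsq z + normsq w).
Proof.
move: z w => [a b] [c d]; rewrite /normsq /=.
have := sqr_ge0 (a - c); have := sqr_ge0 (b - d); rewrite !expr2; nra.
Qed.

Lemma cjD (z w : C) : (z + w)^* = z^* + w^*. Proof. exact: rmorphD. Qed.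
Lemma cjM (z w : C) : (z * w)^* = z^* * w^*. Proof. exact: rmorphM. Qed.
Lemma cjN (z : C) : (- z)^* = - z^*. Proof. exact: rmorphN. Qed.
Lemma cj0 : (0 : C)^* = 0. Proof. exact: rmorph0. Qed.
Lemma cjK (z : C) : z^*^* = z. Proof. exact: conjCK. Qed.

Lemma csummableD X (f g : X -> C) : csummable f -> csummable g ->
  csummable (fun x => f x + g x).
Proof.
move=> [f1 f2] [g1 g2]; split.
  rewrite (_ : (fun x => _) = fun x => complex.Re (f x) + complex.Re (g x)).
    exact: summD.
  by apply/funext => x; case: (f x) (g x) => [? ?] [? ?].
rewrite (_ : (fun x => _) = fun x => complex.Im (f x) + complex.Im (g x)).
  exact: summD.
by apply/funext => x; case: (f x) (g x) => [? ?] [? ?].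
Qed.

Lemma csumD X (f g : X -> C) : csummable f -> csummable g ->
  csum (fun x => f x + g x) = csum f + csum g.
Proof.
move=> [f1 f2] [g1 g2]; rewrite /csum.
rewrite (_ : (fun x => complex.Re (f x + g x)) =
             fun x => complex.Re (f x) + complex.Re (g x)); last first.
  by apply/funext => x; case: (f x) (g x) => [? ?] [? ?].
rewrite (_ : (fun x => complex.Im (f x + g x)) =
             fun x => complex.Im (f x) + complex.Im (g x)); last first.
  by apply/funext => x; case: (f x) (g x) => [? ?] [? ?].
by rewrite !rsumD.
Qed.

Lemma csumZ X (c : C) (f : X -> C) : csummable f ->
  csum (fun x => c * f x) = c * csum f.
Proof.
move: c => [a b] [f1 f2]; rewrite /csum.
rewrite (_ : (fun x => complex.Re (_ * f x)) =
   fun x => a * complex.Re (f x) + (- b) * complex.Im (f x)); last first.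
  by apply/funext => x; case: (f x) => u v /=; rewrite mulNr.
rewrite (_ : (fun x => complex.Im (_ * f x)) =
   fun x => a * complex.Im (f x) + b * complex.Re (f x)); last first.
  by apply/funext => x; case: (f x) => u v /=.
rewrite !rsumD ?rsumZ//; try exact: summZ.
by apply/eqP; rewrite eq_complex /= mulNr !eqxx.
Qed.

Lemma csum_conj X (f : X -> C) : csum (fun x => (f x)^*) = (csum f)^*.
Proof.
apply/eqP; rewrite eq_complex /= -rsumN; apply/andP; split; apply/eqP;
  by congr rsum; apply/funext => x; case: (f x).
Qed.

Lemma csum_pair X Y (f : X * Y -> C) : csummable f ->
  csum f = csum (fun x => csum (fun y => f (x, y))).
Proof.
by move=> [f1 f2]; rewrite /csum /=; congr Complex; rewrite rsum_pair.
Qed.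

Lemma csum_reindex X Y (e : X -> Y) (f : Y -> C) : bijective e ->
  csum f = csum (fun x => f (e x)).
Proof. by move=> be; rewrite /csum; congr Complex; rewrite (rsum_reindex _ be). Qed.

Definition l2 X (f : X -> C) : Prop := summ (fun x => normsq (f x)).

Lemma l2E X (f : X -> C) : l2 f <-> (esumR (fun x => normsq (f x)) < +oo)%E.
Proof. by rewrite /l2 summ_ge0// => x; exact: normsq_ge0. Qed.

Lemma l2_0 X : l2 (fun _ : X => 0).
Proof.
apply/l2E; rewrite /esumR esum1 ?ltry// => x _.
by rewrite /normsq /= expr0n addr0.
Qed.

Lemma l2D X (f g : X -> C) : l2 f -> l2 g -> l2 (fun x => f x + g x).
Proof.
move=> f2 g2; have := summZ 2 (summD f2 g2).
rewrite summ_ge0 => [H|x]; last by rewrite mulr_ge0// addr_ge0// normsq_ge0.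
apply: summ_le H => x; rewrite ger0_norm ?normsq_ge0//; exact: normsqD.
Qed.

Lemma l2Z X (c : C) (f : X -> C) : l2 f -> l2 (fun x => c * f x).
Proof.
move=> f2; rewrite /l2 (_ : (fun x => _) = fun x => normsq c * normsq (f x)).
  exact: summZ.
by apply/funext => x; rewrite normsqM.
Qed.

Lemma l2_csummable X (f g : X -> C) : l2 f -> l2 g ->
  csummable (fun x => f x * (g x)^*).
Proof.
move=> f2 g2; have := summD f2 g2.
rewrite summ_ge0 => [H|x]; last by rewrite addr_ge0// normsq_ge0.
split; apply: summ_le H => x; case: (f x) (g x) => [a b] [c d];
  rewrite /normsq /= ler_norml; apply/andP; split;
  have := sqr_ge0 (a - c); have := sqr_ge0 (b - d);
  have := sqr_ge0 (a + c); have := sqr_ge0 (b + d);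
  have := sqr_ge0 (a - d); have := sqr_ge0 (b - c);
  have := sqr_ge0 (a + d); have := sqr_ge0 (b + c); rewrite !expr2; nra.
Qed.

Definition l2pred X : {pred X -> C} := fun f => `[< l2 f >].

Record ell2 X := Ell2 { ell2_val :> X -> C; _ : ell2_val \in @l2pred X }.
HB.instance Definition _ X := [isSub for @ell2_val X].
HB.instance Definition _ X := [Choice of ell2 X by <:].

Lemma l2_submod_closed X : submod_closed (@l2pred X).
Proof.
split; first by apply/asboolP; exact: l2_0.
move=> a f g /asboolP f2 /asboolP g2; apply/asboolP.
exact: (l2D (l2Z a f2) g2).
Qed.
HB.instance Definition _ X := GRing.isSubmodClosed.Build _ _ (@l2pred X)
  (@l2_submod_closed X).
HB.instance Definition _ X := [SubChoice_isSubLmodule of ell2 X by <:].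

Lemma ell2P X (f : ell2 X) : l2 f.
Proof. by case: f => f /= /asboolP. Qed.

Lemma ell2_eq X (f g : ell2 X) : (forall x, f x = g x) -> f = g.
Proof. by move=> fg; apply/val_inj/funext. Qed.

Definition mkEll2 X (f : X -> C) (hf : l2 f) : ell2 X :=
  @Ell2 X f (introT (asboolP _) hf).

Lemma ell2DE X (f g : ell2 X) x : (f + g) x = f x + g x. Proof. by []. Qed.
Lemma ell2NE X (f : ell2 X) x : (- f) x = - f x. Proof. by []. Qed.
Lemma ell2ZE X (c : C) (f : ell2 X) x : (c *: f) x = c * f x. Proof. by []. Qed.
Lemma ell20E X x : (0 : ell2 X) x = 0. Proof. by []. Qed.

(* Linear in the first variable. *)
Definition inner X (f g : ell2 X) : C := csum (fun x => f x * (g x)^*).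

Lemma innerDl X (f g h : ell2 X) : inner (f + g) h = inner f h + inner g h.
Proof.
rewrite /inner -csumD; try by apply: l2_csummable; exact: ell2P.
by congr csum; apply/funext => x; rewrite ell2DE mulrDl.
Qed.

Lemma innerZl X c (f h : ell2 X) : inner (c *: f) h = c * inner f h.
Proof.
rewrite /inner -csumZ; try by apply: l2_csummable; exact: ell2P.
by congr csum; apply/funext => x; rewrite ell2ZE mulrA.
Qed.

Lemma inner_conj X (f g : ell2 X) : inner f g = (inner g f)^*.
Proof.
rewrite /inner -csum_conj; congr csum; apply/funext => x.
by rewrite cjM cjK mulrC.
Qed.

Lemma innerDr X (f g h : ell2 X) : inner h (f + g) = inner h f + inner h g.
Proof. by rewrite inner_conj innerDl cjD -!inner_conj. Qed.

Lemma innerZr X c (f h : ell2 X) : inner h (c *: f) = c^* * inner h f.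
Proof. by rewrite inner_conj innerZl cjM -inner_conj. Qed.

Lemma innerNl X (f h : ell2 X) : inner (- f) h = - inner f h.
Proof. by rewrite -scaleN1r innerZl mulN1r. Qed.

Lemma innerNr X (f h : ell2 X) : inner h (- f) = - inner h f.
Proof. by rewrite inner_conj innerNl cjN -inner_conj. Qed.

Lemma inner0l X (f : ell2 X) : inner 0 f = 0.
Proof. by rewrite -(scale0r 0) innerZl mul0r. Qed.

Lemma inner0r X (f : ell2 X) : inner f 0 = 0.
Proof. by rewrite inner_conj inner0l cj0. Qed.

Definition nrm X (f : ell2 X) : R := Num.sqrt (complex.Re (inner f f)).

Lemma innerff X (f : ell2 X) :
  complex.Re (inner f f) = fine (esumR (fun x => normsq (f x))).
Proof.
rewrite /inner /csum /= -rsum_ge0E; last by move=> x; exact: normsq_ge0.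
congr rsum; apply/funext => x; case: (f x) => a b /=.
by rewrite /normsq /= mulrN opprK -!expr2.
Qed.

Lemma innerff_ge0 X (f : ell2 X) : 0 <= complex.Re (inner f f).
Proof.
by rewrite innerff fine_ge0// esumR_ge0// => x; exact: normsq_ge0.
Qed.

Lemma nrm_ge0 X (f : ell2 X) : 0 <= nrm f. Proof. exact: sqrtr_ge0. Qed.

Lemma nrm_sq X (f : ell2 X) : nrm f ^+ 2 = complex.Re (inner f f).
Proof. by rewrite sqr_sqrtr// innerff_ge0. Qed.

Lemma innerff_eq0 X (f : ell2 X) : complex.Re (inner f f) = 0 -> f = 0.
Proof.
rewrite innerff => H; apply: ell2_eq => x; rewrite ell20E.
apply: normsq_eq0; apply/eqP; rewrite eq_le normsq_ge0 andbT.
rewrite -H -lee_fin fineK; last first.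
  apply: (@fin_esumR _ _ (fun x => normsq (f x))).
    by move=> ?; exact: normsq_ge0.
  exact: ((l2E (ell2_val f)).1 (ell2P f)).
rewrite [leRHS](esumID [set x]) => [|? _]; last by rewrite lee_fin normsq_ge0.
rewrite setTI esum_set1 ?lee_fin ?normsq_ge0// leeDl// esum_ge0// => ? _.
by rewrite lee_fin normsq_ge0.
Qed.

Lemma inner_inj X (f g : ell2 X) : (forall h, inner h f = inner h g) -> f = g.
Proof.
move=> H; apply/eqP; rewrite -subr_eq0; apply/eqP/innerff_eq0.
by rewrite innerDr innerNr H subrr.
Qed.

Lemma inner_injl X (f g : ell2 X) : (forall h, inner f h = inner g h) -> f = g.
Proof.
by move=> H; apply: inner_inj => h; rewrite inner_conj H -inner_conj.
Qed.

Lemma cauchy_schwarz X (f g : ell2 X) : complex.Re (inner f g) <= nrm f * nrm g.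
Proof.
have [g0|g0] := eqVneq (nrm g) 0.
  have -> : g = 0 by apply: innerff_eq0; rewrite -nrm_sq g0 expr0n.
  by rewrite inner0r /= mulr_ge0// nrm_ge0.
have gp : 0 < nrm g by rewrite lt_neqAle eq_sym g0 nrm_ge0.
have Gp : 0 < complex.Re (inner g g) by rewrite -nrm_sq exprn_gt0.
set c := complex.Re (inner f g).
have := innerff_ge0 (f - (Complex (c / complex.Re (inner g g)) 0) *: g).
rewrite innerDl !innerDr !innerNl !innerNr !innerZl !innerZr (inner_conj g f).
move: @c Gp; rewrite /nrm -sqrtrM ?innerff_ge0//.
case: (inner f f) (inner f g) (inner g g) => [a b] [c d] [e h] /= e0.
rewrite !(mul0r, mulr0, subr0, addr0, add0r, oppr0, sub0r).
move=> H; have {}H : 0 <= a - c ^+ 2 / e.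
  apply: le_trans H _; rewrite le_eqVlt; apply/orP; left; apply/eqP.
  by field; rewrite gt_eqF.
rewrite (le_trans (ler_norm _))// -sqrtr_sqr ler_wsqrtr//.
by rewrite -ler_pdivrMr// -subr_ge0.
Qed.

Lemma nrmD X (f g : ell2 X) : nrm (f + g) <= nrm f + nrm g.
Proof.
rewrite -(@ler_pXn2r _ 2) ?nnegrE ?addr_ge0 ?nrm_ge0//.
rewrite nrm_sq innerDl !innerDr (inner_conj g f) sqrrD.
have := cauchy_schwarz f g; rewrite !nrm_sq.
case: (inner f f) (inner f g) (inner g g) => [a b] [c d] [e h] /= H.
lra.
Qed.

Lemma nrmZ X (c : C) (f : ell2 X) :
  nrm (c *: f) = ComplexField.Normc.normc c * nrm f.
Proof.
rewrite /nrm innerZl innerZr; case: c => a b; have := innerff_ge0 f.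
have : complex.Im (inner f f) = 0.
  have := inner_conj f f; case: (inner f f) => x y [] /= H; lra.
case: (inner f f) => x y /= -> x0.
rewrite -sqrtrM ?addr_ge0 ?sqr_ge0//; congr Num.sqrt; ring.
Qed.

Lemma nrmN X (f : ell2 X) : nrm (- f) = nrm f.
Proof. by rewrite /nrm innerNl innerNr opprK. Qed.

Lemma nrm_eq0 X (f : ell2 X) : nrm f = 0 -> f = 0.
Proof. by move=> H; apply: innerff_eq0; rewrite -nrm_sq H expr0n. Qed.

End Ell2.

Section Operators.
Variable R : realType.
Local Notation C := R[i].
Implicit Types X Y Z : choiceType.

(* Bounded adjointable operators; linearity follows from adjointability. *)
Record bop X Y := Bop {
  opfun :> ell2 R X -> ell2 R Y;
  opadj : ell2 R Y -> ell2 R X;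
  opadjP : forall f g, inner (opfun f) g = inner f (opadj g);
  opbndP : exists M : R, forall f, nrm (opfun f) <= M * nrm f
}.

Definition op_le X Y (T : bop X Y) (M : R) : Prop :=
  forall f, nrm (T f) <= M * nrm f.

Lemma opadjP' X Y (T : bop X Y) f g : inner (opadj T f) g = inner f (T g).
Proof. by rewrite inner_conj -opadjP -inner_conj. Qed.

Lemma opbnd_ge0 X Y (T : bop X Y) : exists2 M : R, 0 <= M & op_le T M.
Proof.
have [M HM] := opbndP T; exists `|M| => // f.
by apply: le_trans (HM f) _; rewrite ler_wpM2r ?nrm_ge0// ler_norm.
Qed.

Lemma bop_eq X Y (S T : bop X Y) : (forall f, S f = T f) -> S = T.
Proof.
case: S T => [s s' sP sB] [t t' tP tB] /= /funext st; rewrite -{}st in tP tB *.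
have e : s' = t'.
  by apply/funext => g; apply: inner_inj => h; rewrite -sP tP.
rewrite -{}e in tP *; congr Bop; exact: Prop_irrelevance.
Qed.

Lemma opD X Y (T : bop X Y) f g : T (f + g) = T f + T g.
Proof. by apply: inner_injl => h; rewrite innerDl !opadjP innerDl. Qed.
Lemma opZ X Y (T : bop X Y) c f : T (c *: f) = c *: T f.
Proof. by apply: inner_injl => h; rewrite innerZl !opadjP innerZl. Qed.

HB.instance Definition _ X Y := gen_eqMixin (bop X Y).
HB.instance Definition _ X Y := gen_choiceMixin (bop X Y).

Lemma adj_bnd X Y (T : bop X Y) :
  exists M : R, forall g, nrm (opadj T g) <= M * nrm g.
Proof.
have [M M0 HM] := opbnd_ge0 T; exists M => g.
have [->|n0] := eqVneq (nrm (opadj T g)) 0; first by rewrite mulr_ge0// nrm_ge0.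
have np : 0 < nrm (opadj T g) by rewrite lt_neqAle eq_sym n0 nrm_ge0.
rewrite -(ler_pM2l np) -expr2 nrm_sq -opadjP.
apply: le_trans (cauchy_schwarz _ _) _.
by rewrite mulrA ler_wpM2r ?nrm_ge0// mulrC HM.
Qed.

Definition badj X Y (T : bop X Y) : bop Y X :=
  @Bop Y X (opadj T) T (@opadjP' X Y T) (adj_bnd T).

Program Definition bcomp X Y Z (S : bop Y Z) (T : bop X Y) : bop X Z :=
  @Bop X Z (fun f => S (T f)) (fun g => opadj T (opadj S g)) _ _.
Next Obligation. by move=> X Y Z S T f g; rewrite !opadjP. Qed.
Next Obligation.
move=> X Y Z S T; have [M M0 HM] := opbnd_ge0 S; have [N HN] := opbndP T.
exists (M * N) => f; apply: le_trans (HM _) _.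
by rewrite -mulrA ler_wpM2l.
Qed.

Program Definition bid X : bop X X := @Bop X X id id _ _.
Next Obligation. by []. Qed.
Next Obligation. by exists 1 => f; rewrite mul1r. Qed.

Program Definition badd X Y (S T : bop X Y) : bop X Y :=
  @Bop X Y (fun f => S f + T f) (fun g => opadj S g + opadj T g) _ _.
Next Obligation. by move=> X Y S T f g; rewrite innerDl innerDr !opadjP. Qed.
Next Obligation.
move=> X Y S T; have [M HM] := opbndP S; have [N HN] := opbndP T.
exists (M + N) => f; apply: le_trans (nrmD _ _) _.
by rewrite mulrDl lerD.
Qed.

Program Definition bscale X Y (c : C) (T : bop X Y) : bop X Y :=
  @Bop X Y (fun f => c *: T f) (fun g => c^* *: opadj T g) _ _.
Next Obligation.
by move=> X Y c T f g; rewrite innerZl innerZr !opadjP cjK.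
Qed.
Next Obligation.
move=> X Y c T; have [M HM] := opbndP T.
exists (ComplexField.Normc.normc c * M) => f.
rewrite nrmZ -mulrA ler_wpM2l//.
by case: c => a b; exact: sqrtr_ge0.
Qed.

Program Definition bzero X Y : bop X Y := @Bop X Y (fun=> 0) (fun=> 0) _ _.
Next Obligation. by move=> X Y f g; rewrite inner0l inner0r. Qed.
Next Obligation.
by move=> X Y; exists 0 => f; rewrite mul0r /nrm inner0l sqrtr0.
Qed.

Lemma baddA X Y : associative (@badd X Y).
Proof. by move=> r s t; apply: bop_eq => f /=; rewrite addrA. Qed.
Lemma baddC X Y : commutative (@badd X Y).
Proof. by move=> r s; apply: bop_eq => f /=; rewrite addrC. Qed.
Lemma badd0 X Y : left_id (@bzero X Y) (@badd X Y).
Proof. by move=> r; apply: bop_eq => f /=; rewrite add0r. Qed.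
Lemma baddN X Y : left_inverse (@bzero X Y) (bscale (-1)) (@badd X Y).
Proof. by move=> r; apply: bop_eq => f /=; rewrite scaleN1r addNr. Qed.

HB.instance Definition _ X Y := GRing.isZmodule.Build (bop X Y)
  (@baddA X Y) (@baddC X Y) (@badd0 X Y) (@baddN X Y).

Lemma opDE X Y (S T : bop X Y) f : (S + T) f = S f + T f.
Proof. by []. Qed.

Lemma bscaleA X Y c d (T : bop X Y) : bscale c (bscale d T) = bscale (c * d) T.
Proof. by apply: bop_eq => f /=; rewrite scalerA. Qed.
Lemma bscale1 X Y : left_id 1 (@bscale X Y).
Proof. by move=> T; apply: bop_eq => f /=; rewrite scale1r. Qed.
Lemma bscaleDr X Y : right_distributive (@bscale X Y) +%R.
Proof. by move=> c S T; apply: bop_eq => f /=; rewrite scalerDr. Qed.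
Lemma bscaleDl X Y (T : bop X Y) : {morph (fun c => bscale c T) : a b / a + b}.
Proof. by move=> c d; apply: bop_eq => f /=; rewrite scalerDl. Qed.

HB.instance Definition _ X Y := GRing.Zmodule_isLmodule.Build C (bop X Y)
  (@bscaleA X Y) (@bscale1 X Y) (@bscaleDr X Y) (@bscaleDl X Y).

Lemma bcompA X : associative (@bcomp X X X).
Proof. by move=> r s t; apply: bop_eq. Qed.
Lemma bcomp1l X : left_id (bid X) (@bcomp X X X).
Proof. by move=> r; apply: bop_eq. Qed.
Lemma bcomp1r X : right_id (bid X) (@bcomp X X X).
Proof. by move=> r; apply: bop_eq. Qed.
Lemma bcompDl X : left_distributive (@bcomp X X X) +%R.
Proof. by move=> r s t; apply: bop_eq. Qed.
Lemma bcompDr X : right_distributive (@bcomp X X X) +%R.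
Proof. by move=> r s t; apply: bop_eq => f /=; rewrite opD. Qed.

HB.instance Definition _ X := GRing.Zmodule_isPzRing.Build (bop X X)
  (@bcompA X) (@bcomp1l X) (@bcomp1r X) (@bcompDl X) (@bcompDr X).

End Operators.

Section Tensor.
Variable R : realType.
Local Notation C := R[i].
Implicit Types X Y Z : choiceType.
Local Notation ell2 := (ell2 R).
Local Notation bop := (bop R).

Lemma row_l2 X Y (f : ell2 (X * Y)%type) x : l2 (fun y => f (x, y)).
Proof. exact: (summ_row x (ell2P f)). Qed.

Definition ell2_row X Y (f : ell2 (X * Y)%type) x : ell2 Y :=
  mkEll2 (row_l2 f x).

Lemma inner_rows X Y (f g : ell2 (X * Y)%type) :
  inner f g = csum (fun x => inner (ell2_row f x) (ell2_row g x)).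
Proof.
by rewrite /inner csum_pair//; apply: l2_csummable; exact: ell2P.
Qed.

Lemma l2_rows X Y (h : X -> ell2 Y) :
  l2 (fun p : X * Y => h p.1 p.2) <-> summ (fun x => nrm (h x) ^+ 2).
Proof.
have S (x : X) : nrm (h x) ^+ 2 = fine (esumR (fun y => normsq (h x y))).
  by rewrite nrm_sq innerff.
rewrite l2E summ_ge0 => [|x]; last exact: sqr_ge0.
rewrite esumR_pair => [|p]; last exact: normsq_ge0.
rewrite (_ : esumR _ = \esum_(x in setT) esumR (fun y => normsq (h x y)))//.
apply: eq_esum => x _; rewrite S fineK//.
apply: (@fin_esumR _ _ (fun y => normsq (h x y))).
  by move=> y; exact: normsq_ge0.
exact: ((l2E (ell2_val (h x))).1 (ell2P (h x))).
Qed.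

Lemma summ_row_nrm X Y (f : ell2 (X * Y)%type) :
  summ (fun x => nrm (ell2_row f x) ^+ 2).
Proof.
apply/l2_rows; rewrite (_ : (fun p => _) = ell2_val f); first exact: ell2P.
by apply/funext => -[].
Qed.

Lemma amp_summ X Y Z (T : bop Y Z) (f : ell2 (X * Y)%type) M : 0 <= M ->
  op_le T M ->
  forall x, nrm (T (ell2_row f x)) ^+ 2 <= M ^+ 2 * nrm (ell2_row f x) ^+ 2.
Proof.
by move=> M0 HM x; rewrite -exprMn ler_pXn2r ?nnegrE ?mulr_ge0 ?nrm_ge0//; exact: HM.
Qed.

Lemma amp_l2 X Y Z (T : bop Y Z) (f : ell2 (X * Y)%type) :
  l2 (fun p : X * Z => T (ell2_row f p.1) p.2).
Proof.
apply/(l2_rows (fun x => T (ell2_row f x))).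
have [M M0 HM] := opbnd_ge0 T.
have := summZ (M ^+ 2) (summ_row_nrm f); rewrite summ_ge0 => [|x]; last first.
  by rewrite mulr_ge0// sqr_ge0.
by apply: summ_le => x; rewrite ger0_norm ?sqr_ge0//; exact: amp_summ.
Qed.

Definition amp_fun X Y Z (T : bop Y Z) (f : ell2 (X * Y)%type) :
  ell2 (X * Z)%type := mkEll2 (amp_l2 T f).

Lemma amp_row X Y Z (T : bop Y Z) (f : ell2 (X * Y)%type) x :
  ell2_row (amp_fun T f) x = T (ell2_row f x).
Proof. exact: ell2_eq. Qed.

Lemma nrm_rows X Y (f : ell2 (X * Y)%type) :
  nrm f ^+ 2 = rsum (fun x => nrm (ell2_row f x) ^+ 2).
Proof.
rewrite nrm_sq inner_rows /csum /=.
by congr rsum; apply/funext => x; rewrite nrm_sq.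
Qed.

Lemma amp_bnd X Y Z (T : bop Y Z) :
  exists M : R, forall f : ell2 (X * Y)%type, nrm (amp_fun T f) <= M * nrm f.
Proof.
have [M M0 HM] := opbnd_ge0 T; exists M => f.
rewrite -(@ler_pXn2r _ 2) ?nnegrE ?mulr_ge0 ?nrm_ge0//.
have P g x : 0 <= nrm (g x : ell2 Z) ^+ 2 by exact: sqr_ge0.
have Q x : 0 <= nrm (ell2_row f x) ^+ 2 by exact: sqr_ge0.
rewrite exprMn !nrm_rows -rsumZ; last exact: summ_row_nrm.
rewrite !rsum_ge0E => [|x|x]; [|by rewrite mulr_ge0// sqr_ge0|exact: sqr_ge0].
have F1 : (esumR (fun x => (M ^+ 2 * nrm (ell2_row f x) ^+ 2)%R) < +oo)%E.
  by rewrite -summ_ge0; [exact/summZ/summ_row_nrm|move=> x; rewrite mulr_ge0// sqr_ge0].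
have F2 : (esumR (fun x => (nrm (ell2_row (amp_fun T f) x) ^+ 2)%R) < +oo)%E.
  by rewrite -summ_ge0; [exact: summ_row_nrm|move=> x; exact: sqr_ge0].
rewrite -lee_fin !fineK.
- by apply: le_esumR => x; rewrite amp_row; exact: amp_summ.
- by apply: fin_esumR F1 => x; rewrite mulr_ge0// sqr_ge0.
- by apply: fin_esumR F2 => x; exact: sqr_ge0.
Qed.

Lemma amp_adj X Y Z (T : bop Y Z) (f : ell2 (X * Y)%type) g :
  inner (amp_fun T f) g = inner f (amp_fun (badj T) g).
Proof.
rewrite !inner_rows; congr csum; apply/funext => x.
by rewrite !amp_row opadjP.
Qed.

(* (1 (x) T) f (x, y) = (T f(x, .)) y *)
Definition amp X Y Z (T : bop Y Z) : bop (X * Y)%type (X * Z)%type :=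
  Bop (@amp_adj X Y Z T) (amp_bnd X T).

Definition pswap X Y (p : X * Y) : Y * X := (p.2, p.1).
Lemma pswap_bij X Y : bijective (@pswap X Y).
Proof. by exists (@pswap Y X) => -[]. Qed.

Lemma swap_l2 X Y (f : ell2 (X * Y)%type) : l2 (fun p => f (pswap p)).
Proof.
have := ell2P f; rewrite !l2E => H.
by rewrite -(esumR_reindex (fun p => normsq (f p)) (pswap_bij Y X)).
Qed.
Definition swap_fun X Y (f : ell2 (X * Y)%type) : ell2 (Y * X)%type :=
  mkEll2 (swap_l2 f).
Lemma swap_adj X Y (f : ell2 (X * Y)%type) g :
  inner (swap_fun f) g = inner f (swap_fun g).
Proof.
rewrite /inner (csum_reindex _ (pswap_bij X Y)).
by congr csum; apply/funext => -[].
Qed.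
Lemma swap_bnd X Y :
  exists M : R, forall f : ell2 (X * Y)%type, nrm (swap_fun f) <= M * nrm f.
Proof.
exists 1 => f; rewrite mul1r /nrm swap_adj.
by rewrite (_ : swap_fun _ = f)//; apply: ell2_eq => -[].
Qed.
Definition flip X Y : bop (X * Y)%type (Y * X)%type :=
  Bop (@swap_adj X Y) (swap_bnd X Y).

Definition otens X1 Y1 X2 Y2 (a : bop X1 X2) (b : bop Y1 Y2) :
    bop (X1 * Y1)%type (X2 * Y2)%type :=
  bcomp (flip Y2 X2) (bcomp (amp Y2 a) (bcomp (flip X1 Y2) (amp X1 b))).

Lemma tens_l2 X Y (f : ell2 X) (g : ell2 Y) :
  l2 (fun p : X * Y => f p.1 * g p.2).
Proof.
rewrite (_ : (fun p => _) = fun p : X * Y => (f p.1 *: g) p.2)//.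
apply/(l2_rows (fun x => f x *: g)).
rewrite (_ : (fun x => _) = fun x => nrm g ^+ 2 * normsq (f x)).
  exact/summZ/ell2P.
apply/funext => x; rewrite nrmZ exprMn mulrC; congr (_ * _).
by case: (f x) => a b /=; rewrite sqr_sqrtr// addr_ge0 ?sqr_ge0.
Qed.
Definition tens X Y (f : ell2 X) (g : ell2 Y) : ell2 (X * Y)%type :=
  mkEll2 (tens_l2 f g).

Lemma otensE X1 Y1 X2 Y2 (a : bop X1 X2) (b : bop Y1 Y2) f g :
  otens a b (tens f g) = tens (a f) (b g).
Proof.
apply: ell2_eq => -[x y] /=; rewrite /pswap /=.
rewrite (_ : ell2_row _ y = (b g y) *: f) ?opZ ?ell2ZE 1?mulrC//.
apply: ell2_eq => z; rewrite ell2ZE /= /pswap /=.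
rewrite (_ : ell2_row _ z = f z *: g) ?opZ ?ell2ZE 1?mulrC//.
exact: ell2_eq.
Qed.

End Tensor.

HB.mixin Record isCStarAlgebra (R : realType) (A : Type)
    of GRing.Algebra R[i] A := {
  star : A -> A;
  cnorm : A -> R;
  starK : involutive star;
  starD : {morph star : a b / a + b};
  starZ : forall (c : R[i]) (a : A), star (c *: a) = c^* *: star a;
  starM : forall a b : A, star (a * b) = star b * star a;
  cnorm_eq0 : forall a : A, cnorm a = 0 -> a = 0;
  cnormD : forall a b : A, cnorm (a + b) <= cnorm a + cnorm b;
  cnormZ : forall (c : R[i]) (a : A),
    cnorm (c *: a) = ComplexField.Normc.normc c * cnorm a;
  cnormM : forall a b : A, cnorm (a * b) <= cnorm a * cnorm b;
  cnorm_star : forall a : A, cnorm (star a * a) = cnorm a ^+ 2;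
  cnorm_complete : forall s : nat -> A,
    (forall e : R, 0 < e -> exists N : nat, forall m n : nat,
      (N <= m)%N -> (N <= n)%N -> cnorm (s m - s n) <= e) ->
    exists a : A, forall e : R, 0 < e -> exists N : nat, forall n : nat,
      (N <= n)%N -> cnorm (s n - a) <= e
}.
#[short(type="cstarAlgType")]
HB.structure Definition CStarAlgebra (R : realType) :=
  { A of GRing.Algebra R[i] A & isCStarAlgebra R A }.

Section Matrices.
Variables (B : pzRingType) (st : B -> B).

Definition adjmx n (w : 'M[B]_n) : 'M[B]_n := map_mx st w^T.

Definition unitary_mx n (w : 'M[B]_n) : Prop :=
  adjmx w *m w = 1%:M /\ w *m adjmx w = 1%:M.

End Matrices.

Section OperatorAlgebras.
Variable R : realType.
Local Notation C := R[i].
Local Notation bop := (bop R).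
Local Notation ell2 := (ell2 R).

Lemma delta_l2 (X : choiceType) (x : X) : l2 (fun y => ((y == x)%:R : C)).
Proof.
have N0 y : 0 <= normsq ((y == x)%:R : C) by exact: normsq_ge0.
apply/l2E; rewrite /esumR (esumID [set x]) => [|? _]; last by rewrite lee_fin.
rewrite setTI esum_set1 ?lee_fin// esum1 => [|y [_ /= yx]].
  by rewrite adde0 ltry.
rewrite (_ : (y == x) = false); last exact/eqP.
by rewrite /normsq /= expr0n addr0.
Qed.

Definition delta (X : choiceType) (x : X) : ell2 X := mkEll2 (delta_l2 x).

Definition op_closed (X : choiceType) (V : set (bop X X)) : Prop :=
  forall T, (forall e : R, 0 < e -> exists2 S, V S & op_le (T - S) e) -> V T.

Definition op_subspace (X : choiceType) (V : set (bop X X)) : Prop :=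
  V 0 /\ forall (c : C) S T, V S -> V T -> V (c *: S + T).

Definition closed_span (X : choiceType) (G : set (bop X X)) : set (bop X X) :=
  smallest (fun V => op_subspace V /\ op_closed V) G.

Definition cstar_subalg (X : choiceType) (V : set (bop X X)) : Prop :=
  [/\ op_subspace V, op_closed V, forall S T, V S -> V T -> V (S * T)
    & forall T, V T -> V (badj T)].

Definition compact_ops (X : choiceType) : set (bop X X) :=
  closed_span [set T | exists xi eta, forall zeta,
    T zeta = inner zeta eta *: xi].

(* Spatial tensor product, represented on the Hilbert space tensor product. *)
Definition tens_alg (X Y : choiceType) (B : set (bop X X)) (D : set (bop Y Y)) :
    set (bop (X * Y)%type (X * Y)%type) :=
  closed_span [set T | exists2 b, B b & exists2 k, D k & T = otens b k].

(* The C*-algebra generated by the unilateral shift (it is unital, since the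
   shift is an isometry). *)
Definition toeplitz : set (bop nat nat) :=
  smallest (@cstar_subalg nat)
    [set T | forall k : nat, T (delta k) = delta k.+1].

Definition fredholm (X : choiceType) (F : bop X X) : Prop :=
  (exists n (s : 'I_n -> ell2 X), forall v, F v = 0 ->
     exists c : 'I_n -> C, v = \sum_i c i *: s i) /\
  (exists n (s : 'I_n -> ell2 X), forall v, exists w (c : 'I_n -> C),
     v = F w + \sum_i c i *: s i).

End OperatorAlgebras.

Section SUq2.
Variables (R : realType) (q : R).
Local Notation C := R[i].
Local Notation bop := (bop R).
Local Notation qC := (q%:C)%C.

(* [sc] is the multiplication by the scalar q, [st] the involution. *)
Definition suq2_rel (B : pzRingType) (sc st : B -> B) (a b : B) : Prop :=
  [/\ st a * a + st b * b = 1,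
      a * st a + sc (sc (b * st b)) = 1,
      a * b = sc (b * a),
      a * st b = sc (st b * a)
    & st b * b = b * st b].

Variable A : cstarAlgType R.

(* Unital *-representations on the Hilbert space l^2(X).  (Contractivity is
   automatic for *-homomorphisms of C*-algebras.) *)
Definition is_rep (X : choiceType) (rho : A -> bop X X) : Prop :=
  [/\ forall (c : C) a b, rho (c *: a + b) = c *: rho a + rho b,
      forall a b, rho (a * b) = rho a * rho b,
      rho 1 = 1,
      forall a, rho (star a) = badj (rho a)
    & forall a, op_le (rho a) (cnorm a)].

Variables alpha beta : A.

Definition generates : Prop := forall V : set A,
  V 1 -> V alpha -> V beta ->
  (forall (c : C) a b, V a -> V b -> V (c *: a + b)) ->
  (forall a b, V a -> V b -> V (a * b)) ->
  (forall a, V a -> V (star a)) ->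
  (forall a, (forall e : R, 0 < e -> exists2 b, V b & cnorm (a - b) <= e) ->
    V a) ->
  forall a, V a.

(* A is the universal C*-algebra generated by alpha and beta subject to the
   relations of SU_q(2).  Every Hilbert space is some l^2(X). *)
Definition is_CSUq2 : Prop :=
  [/\ suq2_rel (fun x : A => qC *: x) (@star R A) alpha beta,
      generates
    & forall (X : choiceType) (a b : bop X X),
        suq2_rel (fun T : bop X X => qC *: T) (@badj R X X) a b ->
        exists rho : A -> bop X X,
          [/\ is_rep rho, rho alpha = a & rho beta = b]].

(* rho = (rho1 (x) rho2) o Delta; the right-hand sides are the images of
   Delta(alpha) and Delta(beta) under rho1 (x) rho2. *)
Definition is_conv (X Y : choiceType) (rho1 : A -> bop X X)
    (rho2 : A -> bop Y Y) (rho : A -> bop (X * Y)%type (X * Y)%type) : Prop :=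
  [/\ is_rep rho,
      rho alpha = otens (rho1 alpha) (rho2 alpha)
                  - qC *: otens (rho1 (star beta)) (rho2 beta)
    & rho beta = otens (rho1 beta) (rho2 alpha)
                 + otens (rho1 (star alpha)) (rho2 beta)].

(* Unitary representation of SU_q(2): u in M_n(A) is unitary with
   Delta(u_ij) = sum_k u_ik (x) u_kj.  The minimal tensor product A (x) A is
   separated by the representations rho1 (x) rho2. *)
Definition is_urep n (u : 'M[A]_n) : Prop :=
  unitary_mx (@star R A) u /\
  forall (X Y : choiceType) (rho1 : A -> bop X X) (rho2 : A -> bop Y Y) rho,
    is_rep rho1 -> is_rep rho2 -> is_conv rho1 rho2 rho ->
    forall i j, rho (u i j) = \sum_k otens (rho1 (u i k)) (rho2 (u k j)).

Definition scmx m n (P : 'M[C]_(m, n)) : 'M[A]_(m, n) := map_mx (in_alg A) P.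

(* No invariant subspace; P ranges over the orthogonal projections of C^n. *)
Definition irreducible_urep n (u : 'M[A]_n) : Prop :=
  (0 < n)%N /\
  forall P : 'M[C]_n, P *m P = P -> adjmx Num.conj P = P ->
    u *m scmx P = scmx P *m u *m scmx P -> P = 0 \/ P = 1%:M.

Definition equiv_urep m n (u : 'M[A]_m) (v : 'M[A]_n) : Prop :=
  exists (S : 'M[C]_(n, m)) (S' : 'M[C]_(m, n)),
    [/\ S *m S' = 1%:M, S' *m S = 1%:M & scmx S *m u = v *m scmx S].

(* Representatives of the equivalence classes of irreducible unitary
   representations, with H_c = C^(d c). *)
Definition irr_family (G : choiceType) (d : G -> nat)
    (u : forall c, 'M[A]_(d c)) : Prop :=
  [/\ forall c, is_urep (u c) /\ irreducible_urep (u c),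
      forall c c', equiv_urep (u c) (u c') -> c = c'
    & forall n (v : 'M[A]_n), is_urep v -> irreducible_urep v ->
        exists c, equiv_urep v (u c)].

End SUq2.

Section Dual.
Variables (R : realType) (G : choiceType) (d : G -> nat).
Local Notation C := R[i].
Local Notation bop := (bop R).
Local Notation ell2 := (ell2 R).

(* A coproduct on prod_c M_(d c): the component of Delta(x) in
   M_(d c1) (x) M_(d c2) depends linearly on the finitely many components of x
   with index in [csupp c1 c2]; the coefficient of the matrix unit E_ab of
   M_(d e) at the entry ((i,k),(j,l)) is [ccoef c1 c2 e a b i j k l]. *)
Record hat_cop := HatCop {
  csupp : G -> G -> seq G;
  ccoef : forall c1 c2 e : G, 'I_(d e) -> 'I_(d e) ->
    'I_(d c1) -> 'I_(d c1) -> 'I_(d c2) -> 'I_(d c2) -> C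
}.

(* The entry ((i,k),(j,l)) of the component (c1, c2) of (Delta (x) id) w. *)
Definition cop_id (D : hat_cop) (V : lmodType C) (w : forall c, 'M[V]_(d c))
    c1 c2 (i j : 'I_(d c1)) (k l : 'I_(d c2)) : V :=
  \sum_(e <- csupp D c1 c2) \sum_a \sum_b
    ccoef D a b i j k l *: w e a b.

(* (Delta (x) id) u = u_23 u_13 *)
Definition is_dual_cop (A : algType C) (u : forall c, 'M[A]_(d c))
    (D : hat_cop) : Prop :=
  forall c1 c2 (i j : 'I_(d c1)) (k l : 'I_(d c2)),
    cop_id D u i j k l = u c2 k l * u c1 i j.

Section Families.
Variable X : choiceType.

(* Families (w_c) with w_c in L(H_c) (x) L(l^2 X). *)
Definition fam := forall c : G, 'M[bop X X]_(d c).

(* The operator norm of w on C^n (x) l^2(X) is at most |M|. *)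
Definition mx_le n (w : 'M[bop X X]_n) (M : R) : Prop :=
  forall f : 'I_n -> ell2 X,
    \sum_i nrm (\sum_j w i j (f j)) ^+ 2 <= M ^+ 2 * \sum_i nrm (f i) ^+ 2.

Definition mxC_le n (a : 'M[C]_n) (M : R) : Prop :=
  forall v : 'I_n -> C,
    \sum_i normsq (\sum_j a i j * v j) <= M ^+ 2 * \sum_i normsq (v i).

Definition fam_bounded (w : fam) : Prop := exists M, forall c, mx_le (w c) M.

(* The c_0-direct sum of the matrix algebras M_(d c). *)
Definition hatA : set (forall c, 'M[C]_(d c)) :=
  [set a : forall c, 'M[C]_(d c) | forall e : R, 0 < e -> exists s : seq G,
     forall c, c \notin s -> mxC_le (a c) e].

(* hatA (x) D for a C*-subalgebra D of L(l^2 X): the c_0-direct sum of the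
   algebras M_(d c)(D). *)
Definition hat_tens (D : set (bop X X)) : set fam :=
  [set w : fam | (forall c i j, D (w c i j)) /\
     forall e : R, 0 < e -> exists s : seq G,
       forall c, c \notin s -> mx_le (w c) e].

(* M(hatA (x) D) for D acting nondegenerately on l^2(X). *)
Definition hat_mult (D : set (bop X X)) : set fam :=
  [set w : fam | fam_bounded w /\ forall x : fam, hat_tens D x ->
     hat_tens D (fun c => w c *m x c) /\ hat_tens D (fun c => x c *m w c)].

(* The elements x of M(hatA (x) K(l^2 X)) such that (a (x) 1) x and x (a (x) 1)
   belong to hatA (x) D for every a in hatA.  For the function algebra
   c_0(Gamma) of a discrete group these are the bounded functions
   Gamma -> D, so that x(g) in D for all g, as in the definition of a Fredholm
   representation of a discrete group; decay of x(g) at infinity is not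
   required.  (The corner entry (alpha^* )^m of the irreducible representation of
   dimension m + 1 shows that w_lambda - w_pi has no such decay: its value at
   e(0,0,0) is a multiple of e(0,m,0), with coefficient
   g(1)/g(m+1) - g(1)g(2)...g(m), bounded away from 0.) *)
Definition hat_local (D : set (bop X X)) : set fam :=
  [set w : fam | fam_bounded w /\ forall a, hatA a ->
     let a1 c : 'M[bop X X]_(d c) := map_mx (fun z : C => z *: bid R X) (a c) in
     hat_tens D (fun c => a1 c *m w c) /\ hat_tens D (fun c => w c *m a1 c)].

(* Unitary representation of the discrete quantum group:
   (Delta (x) id) w = w_23 w_13. *)
Definition unitary_corep (D : hat_cop) (w : fam) : Prop :=
  (forall c, unitary_mx (@badj R X X) (w c)) /\
  forall c1 c2 (i j : 'I_(d c1)) (k l : 'I_(d c2)),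
    cop_id D w i j k l = w c2 k l * w c1 i j.

End Families.

(* Fredholm representation with coefficients in B, a C*-subalgebra of
   L(l^2 X1).  The algebra K(B (x) l^2(X2)) of compact operators of the standard
   Hilbert B-module is identified with B (x) K(l^2 X2). *)
Definition fredholm_rep (D : hat_cop) (X1 X2 : choiceType)
    (B : set (bop X1 X1)) (w1 w2 : fam (X1 * X2)%type)
    (F : bop (X1 * X2)%type (X1 * X2)%type) : Prop :=
  let BK := tens_alg B (@compact_ops R X2) in
  [/\ cstar_subalg B, fredholm F,
      unitary_corep D w1 /\ unitary_corep D w2,
      hat_mult BK w1 /\ hat_mult BK w2
    & hat_local BK (fun c => map_mx (fun T => F * T) (w1 c)
                             - map_mx (fun T => T * F) (w2 c))].

(* w_rho = (id (x) rho) u *)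
Definition w_of (A : algType C) (u : forall c, 'M[A]_(d c)) (X : choiceType)
    (rho : A -> bop X X) : fam X := fun c => map_mx rho (u c).

End Dual.

(* (m, k, l) stands for (n, i, j) with m = 2n, k = n + i, l = n + j; thus
   n - i = m - k, n - j = m - l and 2n + i + j = k + l. *)
Definition Gam := {x : nat * nat * nat | (x.1.2 <= x.1.1)%N && (x.2 <= x.1.1)%N}.

Section Representations.
Variables (R : realType) (q : R).
Local Notation C := R[i].
Local Notation bop := (bop R).
Local Open Scope complex_scope.

Definition gq (k : nat) : R := Num.sqrt (1 - q ^+ (2 * k)).

(* 0 if the index is outside Gam *)
Definition eGam (m k l : nat) : ell2 R Gam :=
  if insub (m, k, l) is Some x then delta R (x : Gam) else 0.

Definition a_plus (m k l : nat) : R :=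
  q ^+ (k + l + 1) * (gq (m - l + 1) * gq (m - k + 1)) / (gq (m + 1) * gq (m + 2)).
Definition a_minus (m k l : nat) : R :=
  if m == 0%N then 0 else gq l * gq k / (gq m * gq (m + 1)).
Definition b_plus (m k l : nat) : R :=
  - q ^+ l * (gq (m - l + 1) * gq (k + 1)) / (gq (m + 1) * gq (m + 2)).
Definition b_minus (m k l : nat) : R :=
  if m == 0%N then 0 else q ^+ k * (gq l * gq (m - k)) / (gq m * gq (m + 1)).

(* The predecessors are harmless: a_minus vanishes if k = 0 or l = 0, and
   b_minus vanishes if l = 0 or k = m. *)
Definition is_lambda (A : cstarAlgType R) (alpha beta : A)
    (lam : A -> bop Gam Gam) : Prop :=
  is_rep lam /\ forall m k l : nat, (k <= m)%N -> (l <= m)%N ->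
    lam alpha (eGam m k l) = (a_plus m k l)%:C *: eGam m.+1 k l
                           + (a_minus m k l)%:C *: eGam m.-1 k.-1 l.-1 /\
    lam beta (eGam m k l) = (b_plus m k l)%:C *: eGam m.+1 k.+1 l
                          + (b_minus m k l)%:C *: eGam m.-1 k l.-1.

(* H_pi = l^2(N x Z) *)
Definition is_pi (A : cstarAlgType R) (alpha beta : A)
    (pi : A -> bop (nat * int)%type (nat * int)%type) : Prop :=
  is_rep pi /\ forall (k : nat) (t : int),
    pi alpha (delta R (k, t)) =
      (if k is k'.+1 then (gq k)%:C *: delta R (k', t) else 0) /\
    pi beta (delta R (k, t)) = (q ^+ k)%:C *: delta R (k, t - 1).

Definition is_U (U : bop Gam (nat * (nat * int))%type) : Prop :=
  forall m k l : nat, (k <= m)%N -> (l <= m)%N ->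
    U (eGam m k l) = (-1) ^+ (maxn k l - l) *:
      delta R ((m - maxn k l)%N, (minn k l, l%:Z - k%:Z)).

End Representations.

(* Main.v *)
Require Import Defs.
From mathcomp Require Import all_boot all_order all_algebra.
From mathcomp Require Import complex.
From mathcomp Require Import boolp classical_sets functions reals.
From mathcomp Require Import constructive_ereal ereal esum.
From mathcomp Require Import topology normedtype sequences realfun.
From mathcomp Require Import ring lra zify.
Import numFieldNormedType.Exports.
Set Implicit Arguments.
Unset Strict Implicit.
Unset Printing Implicit Defensive.
Import Order.TTheory GRing.Theory Num.Theory.
Local Open Scope classical_set_scope.
Local Open Scope ring_scope.

(* Write lamU = U lambda(.) U^* and piI = 1 (x) pi(.), and let BK be the tensor
   product of the Toeplitz algebra T with the compact operators.  The elements a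
   with lamU a - piI a in BK form a closed *-subalgebra, because BK is an algebra
   absorbing piI, and hence also lamU; so it suffices to treat a = alpha, beta.
   In the basis e(r,s,t), lamU alpha - piI alpha and lamU beta - piI beta are sums
   of terms (x (x) y) D, with x a product of unilateral shifts and their adjoints
   in the first variable, y bounded, and D diagonal with a symbol c(r,s,t) that
   converges as r -> oo and is O(|q|^(s+|t|)) uniformly in r.  Convergence puts
   each D_{s,t} in T, and the decay makes D the norm limit of finite sums of the
   operators D_{s,t} (x) (rank one projection).  Since every u^(c) is a finite
   matrix over A, all the claims about w_lambda and w_pi reduce to their entries
   and to the uniform bound coming from unitarity. *)

(** * Operators on l^2 spaces *)

Section SumsAlongInjections.
Variable R : realType.
Local Notation C := R[i].
Variables (X Y : choiceType) (phi : X -> Y).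
Hypothesis phi_inj : injective phi.

Lemma esumR_inj (f : Y -> R) : (forall y, ~ range phi y -> f y = 0) ->
  esumR f = esumR (f \o phi).
Proof.
move=> f0; rewrite /esumR -(esum_image _ phi (fun y => (f y)%:E)); last first.
  by move=> x y _ _; exact: phi_inj.
rewrite [RHS]esum_mkcond; apply: eq_esum => y _; case: ifPn => // /negP.
by rewrite inE => /f0 ->.
Qed.

Lemma csum_inj (f : Y -> C) : (forall y, ~ range phi y -> f y = 0) ->
  csum f = csum (f \o phi).
Proof.
move=> f0; rewrite /csum /rsum.
by congr (Complex (fine _ - fine _) (fine _ - fine _)); apply: esumR_inj;
  move=> y /f0 ->; rewrite /= ?oppr0 maxxx.
Qed.

End SumsAlongInjections.

Section Coordinates.
Variable R : realType.
Local Notation C := R[i].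
Implicit Types X Y : choiceType.
Local Notation ell2 := (ell2 R).
Local Notation bop := (bop R).

Lemma csum1 X (x : X) (f : X -> C) : (forall y, y != x -> f y = 0) ->
  csum f = f x.
Proof.
(* The support [{x}] is the image of an injection from [unit], and a sum over [unit] is the positive
   part minus the negative part of its only term. *)
move=> f0; rewrite (@csum_inj _ _ _ (fun _ : unit => x)).
- have rsum_unit (h : unit -> R) : rsum h = h tt.
    rewrite /rsum /esumR (_ : [set: unit] = [set tt]); last first.
      by apply/seteqP; split => // -[].
    rewrite !esum_set1 ?lee_fin ?le_max ?lexx ?orbT//=.
    by rewrite [RHS](rposneg h tt).
  by rewrite /csum !rsum_unit/=; case: (f x).
- by move=> [] [].
- by move=> y yx; apply: f0; apply/eqP => e; apply: yx; exists tt.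
Qed.

Lemma inner_delta X (f : ell2 X) x : inner f (delta R x) = f x.
Proof.
rewrite /inner (@csum1 _ x) /= ?eqxx.
  by rewrite -[RHS]mulr1; congr (_ * _); exact: rmorph1.
by move=> y /negbTE ->; rewrite cj0 mulr0.
Qed.

Lemma deltaE X (x y : X) : delta R x y = (y == x)%:R. Proof. by []. Qed.

Lemma ell2_coord X (f g : ell2 X) :
  (forall x, inner f (delta R x) = inner g (delta R x)) -> f = g.
Proof. by move=> fg; apply: ell2_eq => x; rewrite -!inner_delta. Qed.

Lemma badjK X Y (T : bop X Y) : badj (badj T) = T.
Proof. exact: bop_eq. Qed.

Lemma badj_inj X Y : injective (@badj R X Y).
Proof. by move=> S T e; rewrite -(badjK S) e badjK. Qed.

Lemma badj_deltaE X Y (T : bop X Y) x y :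
  badj T (delta R y) x = (T (delta R x) y)^*.
Proof. by rewrite -inner_delta opadjP inner_conj inner_delta. Qed.

(** Passing to adjoints replaces a density argument: the coordinate at [x] of [badj S f] is the
    inner product of [f] with [S (delta R x)]. *)
Lemma bop_ext X Y (S T : bop X Y) :
  (forall x, S (delta R x) = T (delta R x)) -> S = T.
Proof.
move=> ST; apply: badj_inj; apply: bop_eq => f; apply: ell2_coord => x.
by rewrite !opadjP /= ST.
Qed.

Lemma badjD X Y (S T : bop X Y) : badj (S + T) = badj S + badj T.
Proof. exact: bop_eq. Qed.
Lemma badjZ X Y c (T : bop X Y) : badj (c *: T) = c^* *: badj T.
Proof. exact: bop_eq. Qed.
Lemma badjN X Y (T : bop X Y) : badj (- T) = - badj T.
Proof. by rewrite -(scaleN1r T) badjZ rmorphN1 scaleN1r. Qed.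
Lemma badjB X Y (S T : bop X Y) : badj (S - T) = badj S - badj T.
Proof. by rewrite badjD badjN. Qed.
Lemma badjM X (S T : bop X X) : badj (S * T) = badj T * badj S.
Proof. exact: bop_eq. Qed.
Lemma badj1 X : badj (1 : bop X X) = 1.
Proof. exact: bop_eq. Qed.

Lemma mulbE X (S T : bop X X) f : (S * T) f = S (T f). Proof. by []. Qed.
Lemma oneE X f : (1 : bop X X) f = f. Proof. by []. Qed.
Lemma opZE X Y c (T : bop X Y) f : (c *: T) f = c *: T f. Proof. by []. Qed.
Lemma op0 X Y (T : bop X Y) : T 0 = 0.
Proof. by rewrite -(scale0r 0) opZ scale0r. Qed.
Lemma opNE X Y (T : bop X Y) f : (- T) f = - T f.
Proof. by rewrite -(scaleN1r T) opZE scaleN1r. Qed.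
Lemma opBE X Y (S T : bop X Y) f : (S - T) f = S f - T f.
Proof. by rewrite opDE opNE. Qed.
Lemma op_sum X Y (T : bop X Y) (I : Type) (r : seq I) P (F : I -> ell2 X) :
  T (\sum_(i <- r | P i) F i) = \sum_(i <- r | P i) T (F i).
Proof. by apply: (big_morph T) => [f g|]; [exact: opD|exact: op0]. Qed.
Lemma sum_opE X Y (I : Type) (r : seq I) P (F : I -> bop X Y) f :
  (\sum_(i <- r | P i) F i) f = \sum_(i <- r | P i) F i f.
Proof. by elim/big_rec2: _ => // i g T _ <-. Qed.

Lemma scalebAl X c (S T : bop X X) : (c *: S) * T = c *: (S * T).
Proof. exact: bop_eq. Qed.
Lemma scalebAr X c (S T : bop X X) : S * (c *: T) = c *: (S * T).
Proof. by apply: bop_eq => f; rewrite !mulbE !opZE opZ. Qed.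

Lemma nrm0 X : nrm (0 : ell2 X) = 0.
Proof. by rewrite /nrm inner0l sqrtr0. Qed.

Lemma nrm_delta X (x : X) : nrm (delta R x) = 1.
Proof. by rewrite /nrm inner_delta deltaE eqxx sqrtr1. Qed.

(** Cauchy-Schwarz bounds [|badj T g|^2 = <T (badj T g), g>] by [M |badj T g| |g|], and one factor
    cancels. The constant is kept explicit so that approximations in norm pass to adjoints. *)
Lemma op_le_adj X Y (T : bop X Y) M : 0 <= M -> op_le T M -> op_le (badj T) M.
Proof.
move=> M0 HM g.
have [->|n0] := eqVneq (nrm (badj T g)) 0; first by rewrite mulr_ge0// nrm_ge0.
have np : 0 < nrm (badj T g) by rewrite lt_neqAle eq_sym n0 nrm_ge0.
rewrite -(ler_pM2l np) -expr2 nrm_sq -opadjP.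
apply: le_trans (cauchy_schwarz _ _) _.
by rewrite mulrA ler_wpM2r ?nrm_ge0// mulrC HM.
Qed.

Lemma op_leW X Y (T : bop X Y) M N : M <= N -> op_le T M -> op_le T N.
Proof.
by move=> MN TM f; apply: le_trans (TM f) _; rewrite ler_wpM2r// nrm_ge0.
Qed.

Lemma op_leD X Y (S T : bop X Y) M N :
  op_le S M -> op_le T N -> op_le (S + T) (M + N).
Proof.
by move=> SM TN f; rewrite opDE mulrDl; apply: le_trans (nrmD _ _) (lerD _ _).
Qed.

Lemma op_leN X Y (T : bop X Y) M : op_le T M -> op_le (- T) M.
Proof. by move=> TM f; rewrite opNE nrmN. Qed.

Lemma op_leM X Y Z (S : bop Y Z) (T : bop X Y) M N : 0 <= M ->
  op_le S M -> op_le T N -> op_le (bcomp S T) (M * N).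
Proof.
by move=> M0 SM TN f /=; apply: le_trans (SM _) _; rewrite -mulrA ler_wpM2l.
Qed.

End Coordinates.

(** * Isometries induced by injections of index sets *)

Section Push.
Variables (R : realType) (X Y : choiceType) (phi : X -> Y).
Hypothesis phi_inj : injective phi.
Local Notation C := R[i].

(** Extension by zero along [phi]. The resulting isometry has composition with [phi] as adjoint; the
    unilateral shift on [nat] and the bilateral shift on [int] are both obtained in this way. *)
Definition push_fun (f : X -> C) (y : Y) : C :=
  if pselect (exists x, phi x = y) is left h then f (sval (cid h)) else 0.

Lemma push_funE f x : push_fun f (phi x) = f x.
Proof.
rewrite /push_fun; case: pselect => [h|[]]; last by exists x.
by congr f; apply: phi_inj; exact: svalP (cid h).
Qed.

Lemma push_fun_out f y : ~ range phi y -> push_fun f y = 0.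
Proof.
move=> ny; rewrite /push_fun; case: pselect => // h; exfalso; apply: ny.
by have [x <-] := h; exists x.
Qed.

Lemma push_esum f :
  esumR (fun y => normsq (push_fun f y)) = esumR (fun x => normsq (f x)).
Proof.
rewrite (esumR_inj phi_inj) => [|y /push_fun_out ->]; last first.
  by rewrite /normsq /= expr0n addr0.
by congr esumR; apply/funext => x /=; rewrite push_funE.
Qed.

Lemma push_l2 (f : ell2 R X) : l2 (push_fun f).
Proof. by apply/l2E; rewrite push_esum -l2E; exact: ell2P. Qed.

(** The zero extension of [f \o phi] is dominated by [f] at every point and has the same sum of
    squares as [f \o phi]. *)
Lemma pull_l2 (f : ell2 R Y) : l2 (f \o phi).
Proof.
apply/l2E; rewrite -push_esum; apply: le_lt_trans ((l2E f).1 (ell2P f)).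
apply: le_esumR => y.
have [[x _ <-]|/push_fun_out ->] := pselect (range phi y).
  by rewrite push_funE.
by rewrite /normsq /= expr0n addr0 normsq_ge0.
Qed.

Definition push_ell2 (f : ell2 R X) : ell2 R Y := mkEll2 (push_l2 f).
Definition pull_ell2 (f : ell2 R Y) : ell2 R X := mkEll2 (pull_l2 f).

Lemma push_adj f g : inner (push_ell2 f) g = inner f (pull_ell2 g).
Proof.
rewrite /inner (csum_inj phi_inj) => [|y /push_fun_out]; last first.
  by move=> /= ->; rewrite mul0r.
by congr csum; apply/funext => x /=; rewrite push_funE.
Qed.

Lemma push_bnd : exists M : R, forall f, nrm (push_ell2 f) <= M * nrm f.
Proof. by exists 1 => f; rewrite mul1r /nrm !innerff push_esum. Qed.

Definition push : bop R X Y := Bop push_adj push_bnd.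

Lemma push_delta x : push (delta R x) = delta R (phi x).
Proof.
apply: ell2_eq => y /=.
have [[x' _ <-]|ny] := pselect (range phi y).
  by rewrite push_funE /= (inj_eq phi_inj).
rewrite push_fun_out//; case: eqP => // e; exfalso; apply: ny.
by exists x.
Qed.

Lemma badj_push_delta x : badj push (delta R (phi x)) = delta R x.
Proof. by apply: ell2_eq => x' /=; rewrite (inj_eq phi_inj). Qed.

Lemma badj_push_delta_out y : ~ range phi y -> badj push (delta R y) = 0.
Proof.
move=> ny; apply: ell2_eq => x' /=; case: eqP => // e; exfalso; apply: ny.
by exists x'.
Qed.

End Push.

(** * Diagonal operators with bounded real symbol *)

Section Diagonal.
Variables (R : realType) (X : choiceType) (c : X -> R) (M : R).
Hypothesis cM : forall x, `|c x| <= M.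
Local Notation C := R[i].

Let normsq_real (a : R) (z : C) : normsq (a%:C%C * z) = a ^+ 2 * normsq z.
Proof. by case: z => u v; rewrite /normsq /=; ring. Qed.

Let diag_le (f : X -> C) x :
  normsq ((c x)%:C%C * f x) <= M ^+ 2 * normsq (f x).
Proof.
rewrite normsq_real ler_wpM2r ?normsq_ge0// -real_normK ?num_real//.
by rewrite lerXn2r ?nnegrE//; apply: le_trans (cM x).
Qed.

Lemma diag_l2 (f : ell2 R X) : l2 (fun x => (c x)%:C%C * f x).
Proof.
apply: (summ_le (g := fun x => M ^+ 2 * normsq (f x))) => [x|].
  by rewrite ger0_norm ?normsq_ge0// diag_le.
rewrite -summ_ge0 => [|x]; last by rewrite mulr_ge0 ?sqr_ge0 ?normsq_ge0.
exact/summZ/ell2P.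
Qed.

Definition diag_ell2 f : ell2 R X := mkEll2 (diag_l2 f).

Lemma diag_adj f g : inner (diag_ell2 f) g = inner f (diag_ell2 g).
Proof.
rewrite /inner; congr csum; apply/funext => x /=.
rewrite cjM mulrA (mulrC (f x)); congr (_ * _ * _).
by apply/eqP; rewrite eq_complex /= oppr0 !eqxx.
Qed.

Lemma diag_nrm f : nrm (diag_ell2 f) <= `|M| * nrm f.
Proof.
rewrite -(@ler_pXn2r _ 2) ?nnegrE ?mulr_ge0 ?nrm_ge0//.
rewrite exprMn real_normK ?num_real// !nrm_sq !innerff -!rsum_ge0E => [||x]; last 2 first.
- by move=> x; exact: normsq_ge0.
- exact: normsq_ge0.
rewrite -rsumZ; last exact: ell2P.
rewrite !rsum_ge0E => [|x|x]; last 2 first.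
- by rewrite mulr_ge0 ?sqr_ge0 ?normsq_ge0.
- exact: normsq_ge0.
have N0 x : 0 <= normsq (diag_ell2 f x) by exact: normsq_ge0.
have N1 x : 0 <= M ^+ 2 * normsq (f x) by rewrite mulr_ge0 ?sqr_ge0 ?normsq_ge0.
have S0 := (l2E (diag_ell2 f)).1 (ell2P (diag_ell2 f)).
have S1 : (esumR (fun x => (M ^+ 2 * normsq (f x))%R) < +oo)%E.
  by rewrite -(summ_ge0 N1); exact/summZ/ell2P.
apply: fine_le (fin_esumR N0 S0) (fin_esumR N1 S1) _.
by apply: le_esumR => x; exact: diag_le.
Qed.

Lemma diag_bnd : exists N : R, forall f, nrm (diag_ell2 f) <= N * nrm f.
Proof. by exists `|M|; exact: diag_nrm. Qed.

(** Since the symbol is real, the operator is its own adjoint. *)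
Definition diag : bop R X X := Bop diag_adj diag_bnd.

Lemma diag_delta x : diag (delta R x) = (c x)%:C%C *: delta R x.
Proof.
apply: ell2_eq => y; rewrite ell2ZE /=; case: eqP => [->//|_].
by rewrite !mulr0.
Qed.

Lemma diag_op_le : op_le diag M.
Proof.
(* The bound [M] can be negative only if [X] is empty, and then the only vector is 0. *)
move=> f; have [[x _]|X0] := pselect (exists x : X, True); last first.
  have -> : f = 0 by apply: ell2_eq => x; exfalso; apply: X0; exists x.
  by rewrite op0 nrm0 mulr0.
have M0 : 0 <= M := le_trans (normr_ge0 _) (cM x).
by have := diag_nrm f; rewrite (ger0_norm M0).
Qed.

End Diagonal.

(** * Operators on tensor products *)

Section TensorOperators.
Variable R : realType.
Local Notation C := R[i].
Implicit Types X Y Z : choiceType.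
Local Notation ell2 := (ell2 R).
Local Notation bop := (bop R).

Lemma tensE X Y (f : ell2 X) (g : ell2 Y) x y : tens f g (x, y) = f x * g y.
Proof. by []. Qed.

Lemma tensDr X Y (f : ell2 X) (g g' : ell2 Y) :
  tens f (g + g') = tens f g + tens f g'.
Proof. by apply: ell2_eq => -[x y]; rewrite ell2DE !tensE mulrDr. Qed.
Lemma tensZl X Y c (f : ell2 X) (g : ell2 Y) : tens (c *: f) g = c *: tens f g.
Proof. by apply: ell2_eq => -[x y]; rewrite ell2ZE !tensE mulrA. Qed.
Lemma tensZr X Y c (f : ell2 X) (g : ell2 Y) : tens f (c *: g) = c *: tens f g.
Proof. by apply: ell2_eq => -[x y]; rewrite ell2ZE !tensE mulrCA. Qed.
Lemma tens0l X Y (g : ell2 Y) : tens (0 : ell2 X) g = 0.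
Proof. by rewrite -(scale0r 0) tensZl scale0r. Qed.
Lemma tens0r X Y (f : ell2 X) : tens f (0 : ell2 Y) = 0.
Proof. by rewrite -(scale0r 0) tensZr scale0r. Qed.

Lemma delta_pair X Y (x : X) (y : Y) :
  delta R (x, y) = tens (delta R x) (delta R y).
Proof.
apply: ell2_eq => -[x' y']; rewrite tensE !deltaE xpair_eqE.
by rewrite -natrM mulnb.
Qed.

Lemma otens_delta X1 Y1 X2 Y2 (a : bop X1 X2) (b : bop Y1 Y2) x y :
  otens a b (delta R (x, y)) = tens (a (delta R x)) (b (delta R y)).
Proof. by rewrite delta_pair otensE. Qed.

Lemma otensM X Y (a a' : bop X X) (b b' : bop Y Y) :
  otens a b * otens a' b' = otens (a * a') (b * b').
Proof. by apply: bop_ext => -[x y]; rewrite mulbE !otens_delta otensE. Qed.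

Lemma badj_otens X Y (a : bop X X) (b : bop Y Y) :
  badj (otens a b) = otens (badj a) (badj b).
Proof.
apply: bop_ext => -[x y]; apply: ell2_eq => -[x' y'].
by rewrite badj_deltaE !otens_delta !tensE cjM !badj_deltaE.
Qed.

Lemma otens1 X Y : otens 1 1 = 1 :> bop (X * Y)%type (X * Y)%type.
Proof. by apply: bop_ext => -[x y]; rewrite otens_delta !oneE delta_pair. Qed.

Lemma amp_tens X Y Z (T : bop Y Z) (f : ell2 X) g :
  amp X T (tens f g) = tens f (T g).
Proof.
apply: ell2_eq => -[x z] /=.
rewrite (_ : ell2_row _ x = f x *: g) ?opZ//.
exact: ell2_eq.
Qed.

(** Transfers the sharp bound of [amp_op_le] to [1 (x) T]. *)
Lemma otens_bid X Y (T : bop Y Y) : otens (bid R X) T = amp X T.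
Proof.
by apply: bop_ext => -[x y]; rewrite otens_delta delta_pair amp_tens.
Qed.

(** The squared norm is the sum of the squared norms of the rows, and [T] acts on each row. The
    constant [M] survives, which the norm clause of [is_rep] requires for [1 (x) pi]. *)
Lemma amp_op_le X Y Z (T : bop Y Z) M : 0 <= M -> op_le T M ->
  op_le (amp X T) M.
Proof.
move=> M0 HM f; rewrite -(@ler_pXn2r _ 2) ?nnegrE ?mulr_ge0 ?nrm_ge0//.
rewrite exprMn !nrm_rows -rsumZ; last exact: summ_row_nrm.
have N0 x : 0 <= nrm (ell2_row (amp X T f) x) ^+ 2 by exact: sqr_ge0.
have N1 x : 0 <= M ^+ 2 * nrm (ell2_row f x) ^+ 2.
  by rewrite mulr_ge0// sqr_ge0.
have S0 := (summ_ge0 N0).1 (summ_row_nrm (amp X T f)).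
have S1 := (summ_ge0 N1).1 (summZ _ (summ_row_nrm f)).
rewrite !rsum_ge0E//; apply: fine_le (fin_esumR N0 S0) (fin_esumR N1 S1) _.
by apply: le_esumR => x; rewrite amp_row; exact: amp_summ.
Qed.

End TensorOperators.

(** * Closed spans, compact operators and the algebra [BK] *)

Section ClosedSpans.
Variable R : realType.
Local Notation C := R[i].
Implicit Types X Y : choiceType.
Local Notation ell2 := (ell2 R).
Local Notation bop := (bop R).

Section Subspaces.
Variables (X : choiceType) (V : set (bop X X)).
Hypothesis subV : op_subspace V.

Lemma op_subspace0 : V 0. Proof. by case: subV. Qed.
Lemma op_subspaceZ c T : V T -> V (c *: T).
Proof. by case: subV => V0 VD VT; rewrite -[_ *: _]addr0; exact: VD. Qed.
Lemma op_subspaceD S T : V S -> V T -> V (S + T).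
Proof. by case: subV => V0 VD VS VT; rewrite -(scale1r S); exact: VD. Qed.
Lemma op_subspaceN T : V T -> V (- T).
Proof. by move=> VT; rewrite -scaleN1r; exact: op_subspaceZ. Qed.
Lemma op_subspaceB S T : V S -> V T -> V (S - T).
Proof. by move=> VS VT; apply: op_subspaceD => //; exact: op_subspaceN. Qed.
Lemma op_subspace_sum (I : eqType) (r : seq I) (F : I -> bop X X) :
  (forall i, i \in r -> V (F i)) -> V (\sum_(i <- r) F i).
Proof.
elim: r => [|i r IH] VF; first by rewrite big_nil; exact: op_subspace0.
rewrite big_cons; apply: op_subspaceD; first by apply: VF; rewrite mem_head.
by apply: IH => j jr; apply: VF; rewrite inE jr orbT.
Qed.

End Subspaces.

Lemma closed_span_subspace X (G : set (bop X X)) : op_subspace (closed_span G).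
Proof.
split=> [V [[sV _] _]|c S T GS GT V HV]; first exact: op_subspace0.
by have [[[_ sV] _] _] := HV; apply: sV; [exact: GS|exact: GT].
Qed.

Lemma closed_span_closed X (G : set (bop X X)) : op_closed (closed_span G).
Proof.
move=> T HT V HV; have [[_ cV] _] := HV; apply: cV => e e0.
by have [S GS TS] := HT e e0; exists S => //; exact: GS.
Qed.

Lemma closed_span_gen X (G : set (bop X X)) T : G T -> closed_span G T.
Proof. by move=> GT V [_]; exact. Qed.

(** The preimage of [W] under a bounded additive map is a closed subspace containing [G], hence
    contains its closed span. The map [sigma] on scalars covers both linear maps (multiplications)
    and the conjugate-linear adjoint. *)
Lemma closed_span_map X Y (G : set (bop X X)) (W : set (bop Y Y))
    (Phi : bop X X -> bop Y Y) (sigma : C -> C) (K : R) :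
  op_subspace W -> op_closed W ->
  (forall S T, Phi (S + T) = Phi S + Phi T) ->
  (forall c T, Phi (c *: T) = sigma c *: Phi T) ->
  (forall T e, 0 <= e -> op_le T e -> op_le (Phi T) (K * e)) ->
  (forall T, G T -> W (Phi T)) ->
  forall T, closed_span G T -> W (Phi T).
Proof.
move=> sW cW PhiD PhiZ PhiK GW T /(_ [set S | W (Phi S)]); apply.
have Phi0 : Phi 0 = 0 by apply: (addrI (Phi 0)); rewrite -PhiD !addr0.
have PhiB S S' : Phi (S - S') = Phi S - Phi S'.
  by apply: (addIr (Phi S')); rewrite -PhiD !subrK.
split; last exact: GW.
split.
  split=> [|c S S' WS WS'] /=; first by rewrite Phi0; exact: op_subspace0.
  by rewrite PhiD PhiZ; apply: (op_subspaceD sW) => //; exact: op_subspaceZ.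
move=> S HS; apply: cW => e e0.
(* A positive number above [K], whatever the sign of [K]: approximating [S] within [e / (|K| + 1)]
   approximates its image within [e]. *)
have K0 : 0 < `|K| + 1 by rewrite ltr_wpDl.
have [S' WS' SS'] := HS _ (divr_gt0 e0 K0); exists (Phi S') => //.
rewrite -PhiB; apply: op_leW (PhiK _ _ _ SS'); last by rewrite ltW// divr_gt0.
rewrite mulrA ler_pdivrMr// mulrC ler_pM2l//.
by apply: le_trans (ler_norm _) _; rewrite lerDl.
Qed.

Lemma closed_span_mull X (G W : set (bop X X)) S :
  op_subspace W -> op_closed W -> (forall T, G T -> W (S * T)) ->
  forall T, closed_span G T -> W (S * T).
Proof.
move=> sW cW; have [M M0 SM] := opbnd_ge0 S.
apply: (closed_span_map (sigma := id) (K := M)) => //.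
- by move=> T T'; rewrite mulrDr.
- by move=> c T; rewrite scalebAr.
- by move=> T e e0 Te; exact: op_leM.
Qed.

Lemma closed_span_mulr X (G W : set (bop X X)) S :
  op_subspace W -> op_closed W -> (forall T, G T -> W (T * S)) ->
  forall T, closed_span G T -> W (T * S).
Proof.
move=> sW cW; have [M M0 SM] := opbnd_ge0 S.
apply: (closed_span_map (Phi := fun T => T * S) (sigma := id) (K := M)) => //.
- by move=> T T'; rewrite mulrDl.
- by move=> c T; rewrite scalebAl.
- by move=> T e e0 Te; rewrite (mulrC M); exact: op_leM.
Qed.

Lemma closed_span_adj X (G W : set (bop X X)) :
  op_subspace W -> op_closed W -> (forall T, G T -> W (badj T)) ->
  forall T, closed_span G T -> W (badj T).
Proof.
move=> sW cW.
apply: (closed_span_map (sigma := fun c => c^*) (K := 1)) => //.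
- by move=> S T; rewrite badjD.
- by move=> c T; rewrite badjZ.
- by move=> T e e0 Te; rewrite mul1r; exact: op_le_adj.
Qed.

Lemma compact_ops_mull X (S T : bop X X) :
  compact_ops T -> compact_ops (S * T).
Proof.
apply: closed_span_mull.
- exact: closed_span_subspace.
- exact: closed_span_closed.
move=> {}T [xi [eta ET]]; apply: closed_span_gen; exists (S xi), eta => zeta.
by rewrite mulbE ET opZ.
Qed.

Lemma compact_ops_adj X (T : bop X X) : compact_ops T -> compact_ops (badj T).
Proof.
apply: closed_span_adj.
- exact: closed_span_subspace.
- exact: closed_span_closed.
move=> {}T [xi [eta ET]]; apply: closed_span_gen; exists eta, xi => zeta.
apply: ell2_coord => x; rewrite opadjP /= ET innerZr innerZl.
by rewrite -inner_conj mulrC.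
Qed.

Section TensorAlgebra.
Variables (X Y : choiceType) (B : set (bop X X)).
Hypothesis Balg : cstar_subalg B.
Local Notation BK := (tens_alg B (@compact_ops R Y)).

Lemma tens_alg_subspace : op_subspace BK.
Proof. exact: closed_span_subspace. Qed.
Lemma tens_alg_closed : op_closed BK.
Proof. exact: closed_span_closed. Qed.

Lemma tens_alg_otens b k : B b -> compact_ops k -> BK (otens b k).
Proof. by move=> Bb Kk; apply: closed_span_gen; exists b => //; exists k. Qed.

(** On a generator the first factor stays in the algebra [B], and the second stays compact for every
    bounded [S] because compact operators form an ideal. This absorbs the shifts in the formulas for
    the generators. *)
Lemma tens_alg_otensl b S T : B b -> BK T -> BK (otens b S * T).
Proof.
move=> Bb; apply: closed_span_mull.
- exact: tens_alg_subspace.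
- exact: tens_alg_closed.
move=> {}T [b' Bb' [k Kk ->]]; rewrite otensM; apply: tens_alg_otens.
  by case: Balg => _ _ + _; exact.
exact: compact_ops_mull.
Qed.

(** The identity leaves the [B]-component of each generator unchanged; this is how [BK] absorbs
    [1 (x) pi]. *)
Lemma tens_alg_ampl S T : BK T -> BK (otens 1 S * T).
Proof.
apply: closed_span_mull.
- exact: tens_alg_subspace.
- exact: tens_alg_closed.
move=> {}T [b' Bb' [k Kk ->]]; rewrite otensM mul1r; apply: tens_alg_otens => //.
exact: compact_ops_mull.
Qed.

Lemma tens_alg_adj T : BK T -> BK (badj T).
Proof.
apply: closed_span_adj.
- exact: tens_alg_subspace.
- exact: tens_alg_closed.
move=> {}T [b Bb [k Kk ->]]; rewrite badj_otens; apply: tens_alg_otens.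
  by case: Balg => _ _ _; exact.
exact: compact_ops_adj.
Qed.

Lemma tens_alg_ampr S T : BK T -> BK (T * otens 1 S).
Proof.
(* Taking adjoints turns right multiplication into left multiplication. *)
move=> KT; rewrite -(badjK (T * _)) badjM badj_otens badj1.
by apply: tens_alg_adj; apply: tens_alg_ampl; exact: tens_alg_adj.
Qed.

Lemma tens_algM S T : BK S -> BK T -> BK (S * T).
Proof.
move=> + KT; move: S; apply: closed_span_mulr.
- exact: tens_alg_subspace.
- exact: tens_alg_closed.
by move=> S [b Bb [k Kk ->]]; exact: tens_alg_otensl.
Qed.

End TensorAlgebra.
End ClosedSpans.

(** * Diagonal operators in the Toeplitz algebra and in BK *)

Section Projections.
Variables (R : realType) (X : choiceType).

Lemma ind_le (x y : X) : `|(y == x)%:R : R| <= 1.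
Proof. by case: (y == x); rewrite ?normr1 ?normr0. Qed.

Definition proj (x : X) : bop R X X := diag (ind_le x).

Lemma proj_delta x y : proj x (delta R y) = (y == x)%:R *: delta R y.
Proof. by rewrite /proj diag_delta; case: (y == x). Qed.

Lemma proj_compact x : compact_ops (proj x).
Proof.
apply: closed_span_gen; exists (delta R x), (delta R x) => f.
apply: ell2_eq => y; rewrite ell2ZE inner_delta /= mulrC.
by case: eqP => [->|_]; rewrite ?mulr1 // !mulr0.
Qed.

End Projections.

(** * The Toeplitz algebra *)

Section Toeplitz.
Variable R : realType.
Local Notation C := R[i].
Local Notation bop := (bop R).

Lemma toeplitz_cstar : cstar_subalg (@toeplitz R).
Proof.
split.
- split=> [V [[sV _ _ _] _]|c S T HS HT V HV]; first exact: op_subspace0.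
  by have [[[_ sV] _ _ _] _] := HV; apply: sV; [exact: HS|exact: HT].
- move=> T HT V HV; have [[_ cV _ _] _] := HV; apply: cV => e e0.
  by have [S HS TS] := HT e e0; exists S => //; exact: HS.
- move=> S T HS HT V HV; have [[_ _ mV _] _] := HV.
  by apply: mV; [exact: HS|exact: HT].
- by move=> T HT V HV; have [[_ _ _ aV] _] := HV; apply: aV; exact: HT.
Qed.

Definition nshift : bop nat nat := push R succn_inj.

Lemma nshift_delta k : nshift (delta R k) = delta R k.+1.
Proof. exact: push_delta. Qed.
Lemma badj_nshift_delta k : badj nshift (delta R k.+1) = delta R k.
Proof. exact: badj_push_delta. Qed.
Lemma badj_nshift_delta0 : badj nshift (delta R 0%N) = 0.
Proof. by apply: badj_push_delta_out => -[]. Qed.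

Lemma nshift_toeplitz : toeplitz nshift.
Proof. by move=> V [_]; apply => k; exact: nshift_delta. Qed.

Lemma toeplitzM S T : toeplitz S -> toeplitz T -> @toeplitz R (S * T).
Proof. by case: toeplitz_cstar => _ _ + _; exact. Qed.
Lemma toeplitz_adj T : toeplitz T -> @toeplitz R (badj T).
Proof. by case: toeplitz_cstar => _ _ _; exact. Qed.
Lemma toeplitz_subspace : op_subspace (@toeplitz R).
Proof. by case: toeplitz_cstar. Qed.

(** [cstar_subalg] does not ask for a unit; it is produced by the shift being an isometry. *)
Lemma toeplitz1 : toeplitz (1 : bop nat nat).
Proof.
rewrite (_ : 1 = badj nshift * nshift).
  exact: toeplitzM (toeplitz_adj nshift_toeplitz) nshift_toeplitz.
by apply: bop_ext => k; rewrite mulbE nshift_delta badj_nshift_delta.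
Qed.

(** With [S] the shift and [p_k] the projection on the basis vector [k], [p_0 = 1 - S S^*] and
    [p_(k+1) = S p_k S^*]. *)
Lemma toeplitz_proj k : toeplitz (proj R k).
Proof.
elim: k => [|k IH].
  rewrite (_ : proj R 0%N = 1 - nshift * badj nshift).
    apply: (op_subspaceB toeplitz_subspace); first exact: toeplitz1.
    exact: toeplitzM nshift_toeplitz (toeplitz_adj nshift_toeplitz).
  apply: bop_ext => -[|n]; rewrite proj_delta opBE mulbE oneE.
    by rewrite badj_nshift_delta0 op0 subr0 scale1r.
  by rewrite badj_nshift_delta nshift_delta subrr scale0r.
rewrite (_ : proj R k.+1 = nshift * (proj R k * badj nshift)).
  apply: toeplitzM nshift_toeplitz _; apply: toeplitzM IH _.
  exact: toeplitz_adj nshift_toeplitz.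
apply: bop_ext => -[|n]; rewrite proj_delta !mulbE.
  by rewrite badj_nshift_delta0 !op0 scale0r.
by rewrite badj_nshift_delta proj_delta opZ nshift_delta eqSS.
Qed.

(** The operator is the norm limit of [L] times the identity plus finite combinations of the
    projections [proj R k]. *)
Lemma toeplitz_diag (c : nat -> R) (M L : R) (cM : forall k, `|c k| <= M) :
  c @ \oo --> L -> toeplitz (diag cM).
Proof.
move=> /cvgrPdist_le cL; case: toeplitz_cstar => sT clT _ _; apply: clT => e e0.
have [N _ HN] := cL _ e0.
exists (L%:C%C *: (1 : bop nat nat) + \sum_(k <- iota 0 N) (c k - L)%:C%C *: proj R k).
  apply: (op_subspaceD sT); first by apply: (op_subspaceZ sT); exact: toeplitz1.
  apply: (op_subspace_sum sT) => k _.
  by apply: (op_subspaceZ sT); exact: toeplitz_proj.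
(* The symbol of the remainder: the finite sum has corrected the first [N] values, and the others
   are within [e] of the limit. *)
pose dif k := if (k < N)%N then 0 else c k - L.
have dife k : `|dif k| <= e.
  rewrite /dif; case: ltnP => kN; first by rewrite normr0 ltW.
  by rewrite distrC; exact: HN.
rewrite (_ : _ - _ = diag dife); first exact: diag_op_le.
apply: bop_ext => n; rewrite opBE opDE sum_opE !diag_delta opZE oneE.
under eq_bigr do rewrite opZE proj_delta scalerA.
rewrite -scaler_suml -scalerDl -scalerBl; congr (_ *: _).
rewrite /dif; case: ltnP => nN.
  rewrite (bigD1_seq n) ?iota_uniq ?mem_iota//= eqxx mulr1 big1 => [|k kn].
    by rewrite addr0 -rmorphD/= -rmorphB/= (addrC L) subrK subrr.
  by rewrite eq_sym (negbTE kn) mulr0.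
rewrite big1_seq ?addr0 -?rmorphB// => k /andP[_]; rewrite mem_iota /= => kN.
by rewrite gtn_eqF ?mulr0// (leq_trans kN).
Qed.

Section DiagonalSymbols.
Variable Y : choiceType.
Local Notation BK := (tens_alg (@toeplitz R) (@compact_ops R Y)).
Variables (c : nat * Y -> R) (M : R) (cM : forall p, `|c p| <= M).

(** Fixing [y] gives a convergent symbol in [r], hence a Toeplitz operator. By uniform smallness
    outside a finite set of [y], finitely many slices, each tensored with a rank one projection,
    approximate the whole operator. *)
Lemma tens_alg_diag :
  (forall y, exists L : R, (fun r => c (r, y)) @ \oo --> L) ->
  (forall e : R, 0 < e -> exists s : seq Y, forall r y, y \notin s ->
     `|c (r, y)| <= e) ->
  BK (diag cM).
Proof.
move=> cL cs; apply: tens_alg_closed => e e0; have [s Hs] := cs e e0.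
pose cy y r := c (r, y).
have cyM y r : `|cy y r| <= M by exact: cM.
(* [undup] ensures that each slice is counted once. *)
exists (\sum_(y <- undup s) otens (diag (cyM y)) (proj R y)).
  apply: (@op_subspace_sum _ _ BK) => [|y _]; first exact: tens_alg_subspace.
  apply: tens_alg_otens; last exact: proj_compact.
  by have [L HL] := cL y; exact: toeplitz_diag HL.
pose dif p := if p.2 \in s then 0 else c p.
have dife p : `|dif p| <= e.
  case: p => r y; rewrite /dif /=; case: ifPn => ys; last exact: Hs.
  by rewrite normr0 ltW.
rewrite (_ : _ - _ = diag dife); first exact: diag_op_le.
apply: bop_ext => -[r y]; rewrite opBE sum_opE !diag_delta.
under eq_bigr do
  rewrite otens_delta proj_delta diag_delta tensZl tensZr scalerA -delta_pair.
rewrite -scaler_suml -scalerBl; congr (_ *: _); rewrite /dif /=.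
case: ifPn => ys.
  rewrite (bigD1_seq y) ?undup_uniq ?mem_undup//= eqxx mulr1 big1 => [|k kn].
    by rewrite addr0 subrr.
  by rewrite eq_sym (negbTE kn) mulr0.
rewrite big1_seq ?subr0// => k /andP[_]; rewrite mem_undup => ks.
by case: eqP ys => [->|_ _]; rewrite ?ks ?mulr0.
Qed.

End DiagonalSymbols.

Lemma tens_alg_diag_geometric (c : nat * (nat * int) -> R) (z K : R)
    (z1 : `|z| < 1) (cM : forall p, `|c p| <= K * `|z| ^+ (p.2.1 + `|p.2.2|)) 
    (cK : forall p, `|c p| <= K) :
  (forall s t, exists L : R, (fun r => c (r, (s, t))) @ \oo --> L) ->
  tens_alg (@toeplitz R) (@compact_ops R (nat * int)%type) (diag cK).
Proof.
move=> cL; apply: tens_alg_diag => [[s t]|e e0]; first exact: cL.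
have K0 : 0 <= K by exact: le_trans (cK (0%N, (0%N, 0))).
have : geometric K `|z| @ \oo --> (0 : R) by apply: cvg_geometric; rewrite normr_id.
move=> /cvgrPdist_le/(_ _ e0)[N _ HN].
(* The box [s < N], [|t| < N] contains all indices with [s + |t| < N], the only ones where the
   geometric bound may exceed [e]. *)
exists [seq (s, t) | s <- iota 0 N,
  t <- [seq Posz k | k <- iota 0 N] ++ [seq - Posz k | k <- iota 0 N]].
move=> r [s t]; apply: contraNT; rewrite -ltNge => ce.
have stN : (s + `|t| < N)%N.
  rewrite ltnNge; apply/negP => /HN /=; rewrite sub0r normrN.
  by rewrite ger0_norm ?mulr_ge0// leNgt (lt_le_trans ce) ?(cM (r, (s, t))).
apply/allpairsP; exists (s, t); split => //=.
  by rewrite mem_iota (leq_ltn_trans _ stN) ?leq_addr.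
rewrite mem_cat; apply/orP.
have tN : (`|t| < N)%N by rewrite (leq_ltn_trans _ stN) ?leq_addl.
have [t0|t0] := leP 0 t; [left|right]; apply/mapP; exists `|t|%N;
  by rewrite ?mem_iota//; lia.
Qed.

End Toeplitz.

(** * The coefficients of the left regular representation *)

Section Coefficients.
Variables (R : realType) (q : R).
Hypotheses (q_lb : -1 < q) (q_ub : q < 1).
Local Notation g := (gq q).

Lemma normq_lt1 : `|q| < 1. Proof. by rewrite ltr_norml q_lb. Qed.

Let nq0 : 0 <= `|q|. Proof. exact: normr_ge0. Qed.
Let nq1 : `|q| <= 1. Proof. exact: ltW normq_lt1. Qed.

(** Only even powers of [q] occur in [g], so negative [q] are handled through [|q|]. *)
Lemma qsq_norm k : q ^+ (2 * k) = `|q| ^+ (2 * k).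
Proof. by rewrite !exprM real_normK ?num_real. Qed.

Lemma gq_sq k : g k ^+ 2 = 1 - `|q| ^+ (2 * k).
Proof. by rewrite /gq sqr_sqrtr qsq_norm// subr_ge0 exprn_ile1. Qed.

Lemma gq0 : g 0 = 0. Proof. by rewrite /gq muln0 expr0 subrr sqrtr0. Qed.

Lemma gq_ge0 k : 0 <= g k. Proof. exact: sqrtr_ge0. Qed.

Lemma gq_homo k l : (k <= l)%N -> g k <= g l.
Proof.
move=> kl; rewrite /gq ler_wsqrtr// !qsq_norm lerB// ler_wiXn2l//.
by rewrite leq_mul2l.
Qed.

Lemma gq_le1 k : g k <= 1.
Proof.
rewrite -(@ler_pXn2r _ 2) ?nnegrE ?gq_ge0// gq_sq expr1n lerBlDr lerDl.
exact: exprn_ge0.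
Qed.

Lemma gq_gt0 k : (0 < k)%N -> 0 < g k.
Proof.
move=> k0; rewrite /gq sqrtr_gt0 subr_gt0 qsq_norm exprn_ilt1 ?normq_lt1//.
by rewrite muln_eq0 /= -lt0n.
Qed.

Lemma gq_cvg n : (fun r => g (r + n)) @ \oo --> (1 : R).
Proof.
have q2 : `|q ^+ 2| < 1 by rewrite normrX exprn_ilt1// normq_lt1.
have : g @ \oo --> (1 : R).
  rewrite -[X in _ --> X]sqrtr1 -[X in Num.sqrt X]subr0.
  apply: (continuous_cvg _ (@sqrt_continuous R _)).
  under eq_fun do rewrite exprM.
  by apply: cvgB; [exact: cvg_cst|exact: cvg_expr].
by rewrite -(cvg_shiftn n).
Qed.

Lemma gq2_gt0 k l : (0 < k)%N -> (0 < l)%N -> 0 < g k * g l.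
Proof. by move=> k0 l0; rewrite mulr_gt0// gq_gt0. Qed.

Lemma gq2_le1 k l : g k * g l <= 1.
Proof. by rewrite mulr_ile1// ?gq_ge0// gq_le1. Qed.

Lemma gq2_cvg n1 n2 : (fun r => g (r + n1) * g (r + n2)) @ \oo --> (1 : R).
Proof.
by have := cvgM (gq_cvg n1) (gq_cvg n2); rewrite mulr1; exact.
Qed.

Lemma inv_gq2_cvg (x : R) n1 n2 :
  (fun r => x / (g (r + n1) * g (r + n2))) @ \oo --> x.
Proof.
have := cvgM (cvg_cst x) (cvgV (oner_neq0 R) (gq2_cvg n1 n2)).
by rewrite invr1 mulr1; exact.
Qed.

Lemma ratio_cvg (x : R) n1 n2 n3 n4 :
  (fun r => x * (g (r + n1) * g (r + n2)) / (g (r + n3) * g (r + n4)))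
    @ \oo --> x.
Proof.
have := cvgM (cvgM (cvg_cst x) (gq2_cvg n1 n2))
  (cvgV (oner_neq0 R) (gq2_cvg n3 n4)).
by rewrite invr1 !mulr1; exact.
Qed.

(** This is the inverse of [g 1 ^+ 2], the largest value of [(g k * g l)^-1] for positive indices,
    as [g] is nondecreasing. *)
Let K := (1 - q ^+ 2)^-1.

Lemma inv_gq2_le k l : (g k * g l)^-1 <= K.
Proof.
have g1 : 1 - q ^+ 2 = g 1 * g 1 by rewrite -expr2 gq_sq muln1 real_normK ?num_real.
have K0 : 0 < 1 - q ^+ 2 by rewrite g1 gq2_gt0.
(* For a zero index the product vanishes, and its inverse is 0 by convention. *)
case: k => [|k]; first by rewrite gq0 mul0r invr0 invr_ge0 ltW.
case: l => [|l]; first by rewrite gq0 mulr0 invr0 invr_ge0 ltW.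
rewrite lef_pV2 ?posrE ?gq2_gt0// g1.
by rewrite ler_pM ?gq_ge0// gq_homo.
Qed.

(** The numerator is at most the denominator, which is at most 1, so the ratio lies between the
    numerator and 1; and the numerator is at least [g j ^+ 2 = 1 - |q|^(2j)]. *)
Lemma ratio_dist_le1 n1 n2 n3 n4 j : (0 < j)%N -> (j <= n1 <= n3)%N ->
  (j <= n2 <= n4)%N ->
  `|g n1 * g n2 / (g n3 * g n4) - 1| <= `|q| ^+ (2 * j).
Proof.
move=> j0 /andP[jn1 n13] /andP[jn2 n24].
have D0 : 0 < g n3 * g n4 by rewrite gq2_gt0//; lia.
have N0 : 0 < g n1 * g n2 by rewrite gq2_gt0//; lia.
have ND : g n1 * g n2 <= g n3 * g n4 by rewrite ler_pM ?gq_ge0 ?gq_homo.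
rewrite distrC ger0_norm; last by rewrite subr_ge0 ler_pdivrMr// mul1r.
rewrite lerBlDr -lerBlDl -gq_sq.
apply: (@le_trans _ _ (g n1 * g n2)).
  by rewrite expr2 ler_pM ?gq_ge0 ?gq_homo.
by rewrite ler_pdivlMr// ler_piMr ?gq2_le1// ltW.
Qed.

(** With a single factor [x = g n1] in the numerator the ratio may exceed 1, so both sides need a
    bound. The denominator lies between [x^2 = 1 - |q|^(2 n1)] and 1, and [K x^2 >= 1]. *)
Lemma ratio_dist_le2 n1 n3 n4 : (0 < n1)%N -> (n1 <= n3)%N -> (n1 <= n4)%N ->
  `|g n1 / (g n3 * g n4) - 1| <= K * `|q| ^+ (2 * n1).
Proof.
move=> n0 n13 n14.
have D0 : 0 < g n3 * g n4 by rewrite gq2_gt0//; lia.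
have x0 := gq_gt0 n0; have x1 := gq_le1 n1.
have D1 : g n1 * g n1 <= g n3 * g n4 by rewrite ler_pM ?gq_ge0 ?gq_homo.
have KD : 1 <= K * (g n1 * g n1).
  by rewrite -ler_pdivrMr ?mulr_gt0// mul1r inv_gq2_le.
have -> : `|q| ^+ (2 * n1) = 1 - g n1 ^+ 2 by rewrite gq_sq opprB addrC subrK.
have D2 := gq2_le1 n3 n4.
have K0 : 0 <= K.
  by apply: le_trans (inv_gq2_le n1 n1); rewrite invr_ge0 mulr_ge0// ltW.
have x2 : g n1 ^+ 2 <= 1 by rewrite expr2 gq2_le1.
rewrite ler_norml; apply/andP; split.
  have K1 : 1 <= K by apply: le_trans KD _; rewrite ler_piMr// gq2_le1.
  have xD : g n1 ^+ 2 <= g n1 / (g n3 * g n4).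
    rewrite ler_pdivlMr//; apply: (@le_trans _ _ (g n1 ^+ 2)).
      by rewrite ler_piMr// sqr_ge0.
    by rewrite expr2 ler_piMr// ltW.
  nra.
(* Upper side: [K x^2 >= 1] gives [(K (1 - x^2) + 1) x^2 >= (1 - x^2) + x^2 = 1 >= x], and [x^2] is
   at most the denominator. *)
rewrite lerBlDr ler_pdivrMr//.
apply: (le_trans x1); apply: (@le_trans _ _ ((K * (1 - g n1 ^+ 2) + 1) * g n1 ^+ 2)).
  nra.
rewrite -expr2 in D1; rewrite ler_wpM2l// addr_ge0// mulr_ge0// subr_ge0//.
Qed.

End Coefficients.

(** * Symbols of the differences on the generators *)

Section Symbols.
Variables (R : realType) (q : R).
Local Notation g := (gq q).

(* [U] maps [e^n_ij] to [e(r,s,t)] up to sign exactly when [2n = r + s + |t|],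
   [n + i = kidx s t] and [n + j = lidx s t]. *)
Definition kidx (s : nat) (t : int) : nat := if 0 < t then s else (s + absz t)%N.
Definition lidx (s : nat) (t : int) : nat := if 0 < t then (s + absz t)%N else s.

(** The five symbols are the coefficients of [lamU - piI] in the basis [e(r,s,t)]. On [alpha],
    [symA1] goes with [r -> r+1] and [symA2] with [s -> s-1]. On [beta], [t] drops by 1, while
    [symB1] fixes [r] and [s], [symB2] raises both and [symB3] lowers both. The terms subtracted in
    [symA2] and [symB1] are the coefficients of [pi]. *)
Definition symA1 (p : nat * (nat * int)) : R :=
  let: (r, (s, t)) := p in
  q ^+ (2 * s + absz t + 1) * (g (r + 1) * g (r + (absz t + 1))) /
    (g (r + (s + absz t + 1)) * g (r + (s + absz t + 2))).

Definition symA2 (p : nat * (nat * int)) : R :=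
  let: (r, (s, t)) := p in
  g (s + absz t) * g s / (g (r + (s + absz t)) * g (r + (s + absz t + 1))) - g s.

(** The offset [a] merges two cases: the main term comes from [b_minus] if [t > 0] and from the
    opposite of [b_plus] if [t <= 0]. It is positive and at least [|t|]. *)
Definition symB1 (p : nat * (nat * int)) : R :=
  let: (r, (s, t)) := p in let a := if 0 < t then absz t else (absz t).+1 in
  q ^+ s * (g (s + a) * g (r + a)) / (g (r + (s + a)) * g (r + (s + a + 1)))
  - q ^+ s.

Definition symB2 (p : nat * (nat * int)) : R :=
  let: (r, (s, t)) := p in
  if 0 < t then - q ^+ (s + absz t) * (g (r + 1) * g (s + 1)) /
    (g (r + (s + absz t + 1)) * g (r + (s + absz t + 2)))
  else 0.

(** The form [r + 0] is the one to which [gq_cvg] applies. *)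
Definition symB3 (p : nat * (nat * int)) : R :=
  let: (r, (s, t)) := p in
  if 0 < t then 0 else - q ^+ (s + absz t) * (g s * g (r + 0)) /
    (g (r + (s + absz t)) * g (r + (s + absz t + 1))).

Lemma a_plus_idx r s t :
  a_plus q (r + s + absz t) (kidx s t) (lidx s t) = symA1 (r, (s, t)).
Proof.
rewrite /a_plus /symA1 /kidx /lidx; case: ifP => _; last rewrite (mulrC (g _));
  congr (q ^+ _ * (g _ * g _) / (g _ * g _)); lia.
Qed.

Lemma a_minus_idx r s t :
  a_minus q (r + s + absz t) (kidx s t) (lidx s t) = symA2 (r, (s, t)) + g s.
Proof.
rewrite /a_minus /symA2 subrK.
(* At [2n = 0] the coefficient is 0 by definition, and the quotient agrees because [g 0 = 0]. *)
case: eqP => [/eqP|_].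
  rewrite !addn_eq0 -andbA => /and3P[/eqP -> /eqP -> /eqP ->].
  by rewrite gq0 mul0r mul0r.
rewrite /kidx /lidx; case: ifP => _; last rewrite (mulrC (g _));
  congr (g _ * g _ / (g _ * g _)); lia.
Qed.

Lemma b_minus_idx_pos r s t : 0 < t ->
  b_minus q (r + s + absz t) (kidx s t) (lidx s t) = symB1 (r, (s, t)) + q ^+ s.
Proof.
rewrite /b_minus /symB1 /kidx /lidx => t0; rewrite t0 subrK.
case: eqP => [|_]; first by lia.
congr (q ^+ _ * (g _ * g _) / (g _ * g _)); lia.
Qed.

Lemma b_plus_idx_npos r s t : t <= 0 ->
  - b_plus q (r + s + absz t) (kidx s t) (lidx s t) = symB1 (r, (s, t)) + q ^+ s.
Proof.
rewrite leNgt => /negbTE t0; rewrite /b_plus /symB1 /kidx /lidx t0 subrK.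
rewrite !mulNr opprK (mulrC (g _)).
congr (q ^+ _ * (g _ * g _) / (g _ * g _)); lia.
Qed.

Lemma b_plus_idx_pos r s t : 0 < t ->
  b_plus q (r + s + absz t) (kidx s t) (lidx s t) = symB2 (r, (s, t)).
Proof.
rewrite /b_plus /symB2 /kidx /lidx => t0; rewrite t0.
congr (- q ^+ _ * (g _ * g _) / (g _ * g _)); lia.
Qed.

Lemma b_minus_idx_npos r s t : t <= 0 ->
  - b_minus q (r + s + absz t) (kidx s t) (lidx s t) = symB3 (r, (s, t)).
Proof.
rewrite leNgt => /negbTE t0; rewrite /b_minus /symB3 /kidx /lidx t0.
case: eqP => [/eqP|_].
  rewrite !addn_eq0 -andbA => /and3P[/eqP -> /eqP -> /eqP ->].
  by rewrite gq0 mul0r mulr0 mul0r oppr0.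
rewrite -!mulNr; congr (- q ^+ _ * (g _ * g _) / (g _ * g _)); lia.
Qed.

Hypotheses (q_lb : -1 < q) (q_ub : q < 1).

Let K := (1 - q ^+ 2)^-1.

Let nq0 : 0 <= `|q|. Proof. exact: normr_ge0. Qed.
Let nq1 : `|q| <= 1. Proof. exact: ltW (normq_lt1 _ _). Qed.

Let K1 : 1 <= K.
Proof.
have q2 : q ^+ 2 < 1.
  by rewrite -real_normK ?num_real// exprn_ilt1 ?normq_lt1.
by rewrite /K -[leLHS]invr1 lef_pV2 ?posrE ?subr_gt0// lerBlDr lerDl sqr_ge0.
Qed.

Let K0 : 0 <= K. Proof. exact: le_trans ler01 K1. Qed.

Let inv_norm n1 n2 : `|(g n1 * g n2)^-1| <= K.
Proof. by rewrite ger0_norm ?inv_gq2_le// invr_ge0 mulr_ge0 ?gq_ge0. Qed.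

Let gq2_norm n1 n2 : `|g n1 * g n2| <= 1.
Proof. by rewrite ger0_norm ?gq2_le1// mulr_ge0 ?gq_ge0. Qed.

Let ratio_norm (x : R) n n1 n2 n3 n4 : `|x| <= `|q| ^+ n ->
  `|x * (g n1 * g n2) / (g n3 * g n4)| <= K * `|q| ^+ n.
Proof.
move=> xn; rewrite [X in X <= _]normrM mulrC ler_pM//.
by rewrite normrM -[leRHS]mulr1 ler_pM.
Qed.

Lemma symA1_le p : `|symA1 p| <= K * `|q| ^+ (p.2.1 + absz p.2.2).
Proof.
case: p => r [s t] /=; apply: ratio_norm; rewrite normrX ler_wiXn2l//; lia.
Qed.

(** The factor [g s] kills the symbol at [s = 0]. For [s > 0], taking it out leaves the distance to
    1 estimated in [ratio_dist_le2], with the positive index [s + |t|]. *)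
Lemma symA2_le p : `|symA2 p| <= K * `|q| ^+ (p.2.1 + absz p.2.2).
Proof.
case: p => r [[|s] t] /=.
  by rewrite gq0 mulr0 mul0r subr0 normr0 mulr_ge0 ?exprn_ge0.
rewrite mulrAC -[X in _ - X]mul1r -mulrBl normrM.
have gs : `|g s.+1| <= 1 by rewrite ger0_norm ?gq_ge0// gq_le1.
rewrite -[leRHS]mulr1; apply: ler_pM => //.
apply: le_trans (ratio_dist_le2 q_lb q_ub _ _ _) _ => //; try lia.
by rewrite ler_wpM2l// ler_wiXn2l//; lia.
Qed.

(** The factor [q ^+ s] gives the decay in [s]; the remaining distance to 1 is at most [|q|^(2a)],
    hence at most [|q|^|t|]. *)
Lemma symB1_le p : `|symB1 p| <= K * `|q| ^+ (p.2.1 + absz p.2.2).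
Proof.
case: p => r [s t] /=; set a := if _ then _ else _.
have [a0 at_] : (0 < a)%N /\ (absz t <= a)%N by rewrite /a; case: ltP => ?; lia.
rewrite -mulrA -[X in _ - X]mulr1 -mulrBr normrM normrX exprD.
apply: (@le_trans _ _ (`|q| ^+ s * `|q| ^+ absz t)); last first.
  by rewrite ler_peMl ?mulr_ge0 ?exprn_ge0.
rewrite ler_wpM2l ?exprn_ge0//;
  apply: le_trans (ratio_dist_le1 _ _ a0 _ _) _ => //; try lia.
by rewrite ler_wiXn2l//; lia.
Qed.

Lemma symB2_le p : `|symB2 p| <= K * `|q| ^+ (p.2.1 + absz p.2.2).
Proof.
case: p => r [s t] /=; case: ifP => _.
  by apply: ratio_norm; rewrite normrN normrX.
by rewrite normr0 mulr_ge0 ?exprn_ge0.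
Qed.

Lemma symB3_le p : `|symB3 p| <= K * `|q| ^+ (p.2.1 + absz p.2.2).
Proof.
case: p => r [s t] /=; case: ifP => _; last first.
  by apply: ratio_norm; rewrite normrN normrX.
by rewrite normr0 mulr_ge0 ?exprn_ge0.
Qed.

Lemma symA1_cvg s t : exists L : R, (fun r => symA1 (r, (s, t))) @ \oo --> L.
Proof. by eexists; apply: ratio_cvg. Qed.

Lemma symA2_cvg s t : exists L : R, (fun r => symA2 (r, (s, t))) @ \oo --> L.
Proof. by eexists; apply: cvgB; [apply: inv_gq2_cvg|exact: cvg_cst]. Qed.

Lemma symB1_cvg s t : exists L : R, (fun r => symB1 (r, (s, t))) @ \oo --> L.
Proof.
eexists; apply: cvgB; last exact: cvg_cst.
apply: cvgM; last by apply: cvgV (gq2_cvg _ _ _ _); rewrite ?oner_neq0.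
by apply: cvgM; [exact: cvg_cst|apply: cvgM; [exact: cvg_cst|exact: gq_cvg]].
Qed.

Lemma symB2_cvg s t : exists L : R, (fun r => symB2 (r, (s, t))) @ \oo --> L.
Proof.
rewrite /symB2; case: (0 < t); last by exists 0; exact: cvg_cst.
eexists; apply: cvgM; last by apply: cvgV (gq2_cvg _ _ _ _); rewrite ?oner_neq0.
by apply: cvgM; [exact: cvg_cst|apply: cvgM; [exact: gq_cvg|exact: cvg_cst]].
Qed.

Lemma symB3_cvg s t : exists L : R, (fun r => symB3 (r, (s, t))) @ \oo --> L.
Proof.
rewrite /symB3; case: (0 < t); first by exists 0; exact: cvg_cst.
eexists; apply: cvgM; last by apply: cvgV (gq2_cvg _ _ _ _); rewrite ?oner_neq0.
by apply: cvgM; [exact: cvg_cst|apply: cvgM; [exact: cvg_cst|exact: gq_cvg]].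
Qed.

(** Records the diagonal operator only through its action on basis vectors, all that the comparison
    on generators uses. *)
Lemma tens_alg_diag_sym (c : nat * (nat * int) -> R) :
  (forall p, `|c p| <= K * `|q| ^+ (p.2.1 + absz p.2.2)) ->
  (forall s t, exists L : R, (fun r => c (r, (s, t))) @ \oo --> L) ->
  exists2 D, tens_alg (@toeplitz R) (@compact_ops R (nat * int)%type) D &
    forall p, D (delta R p) = (c p)%:C%C *: delta R p.
Proof.
move=> cM cL.
have cK p : `|c p| <= K.
  by apply: le_trans (cM p) _; rewrite ler_piMr// exprn_ile1.
exists (diag cK); last exact: diag_delta.
exact: (@tens_alg_diag_geometric _ _ q _ (normq_lt1 _ _)).
Qed.

End Symbols.

(** * The operators U lambda U^* and 1 (x) pi on the generators *)

Section UnitaryU.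
Variable R : realType.
Local Notation C := R[i].
Variable U : bop R Gam (nat * (nat * int))%type.
Hypothesis UP : is_U U.

Lemma eGam_val (x : Gam) : eGam R (val x).1.1 (val x).1.2 (val x).2 = delta R x.
Proof. by rewrite /eGam -!surjective_pairing valK. Qed.

Lemma Gam_le (x : Gam) :
  ((val x).1.2 <= (val x).1.1)%N /\ ((val x).2 <= (val x).1.1)%N.
Proof. exact/andP/(valP x). Qed.

Definition Uidx (x : Gam) : nat * (nat * int) :=
  let: (m, k, l) := val x in
  ((m - maxn k l)%N, (minn k l, l%:Z - k%:Z)).

Definition Usgn (x : Gam) : C := (-1) ^+ (maxn (val x).1.2 (val x).2 - (val x).2).

Lemma U_delta x : U (delta R x) = Usgn x *: delta R (Uidx x).
Proof.
have [xk xl] := Gam_le x; rewrite -eGam_val UP// /Uidx /Usgn.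
by case: (val x) => [[]].
Qed.

(** The minimum and the difference determine [k] and [l]; adding their maximum to the first
    component recovers [m]. *)
Lemma Uidx_inj : injective Uidx.
Proof.
move=> x y; have := Gam_le x; have := Gam_le y; rewrite /Uidx => + + xy.
case ex : (val x) xy => [[m k] l]; case ey : (val y) => [[m' k'] l'] /=.
move=> [e1 e2 e3] [? ?] [? ?]; apply: val_inj; rewrite ex ey.
by congr (_, _, _); lia.
Qed.

Lemma conj_sgn n : ((-1) ^+ n : C)^* = (-1) ^+ n.
Proof. by rewrite rmorphXn rmorphN1. Qed.

Lemma sgn_sq n : (-1) ^+ n * (-1) ^+ n = 1 :> C.
Proof. by rewrite -exprD addnn -mul2n exprM sqrrN !expr1n. Qed.

Lemma badjUU : bcomp (badj U) U = bid R Gam.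
Proof.
apply: bop_ext => x; apply: ell2_coord => y.
rewrite opadjP' !U_delta innerZl innerZr conj_sgn !inner_delta !deltaE /=.
rewrite (inj_eq Uidx_inj); case: eqP => [->|_]; last by rewrite !mulr0.
by rewrite mulr1 sgn_sq.
Qed.

Lemma badjU_U f : badj U (U f) = f.
Proof. by rewrite -[RHS]/(bid R Gam f) -badjUU. Qed.

(** The sign [(-1)^(max(i,j) - j)] as a function of [t = j - i]. *)
Definition tsgn (t : int) : C := (-1) ^+ (if (0 < t)%R then 0%N else absz t).

Lemma tsgn_sq t : tsgn t * tsgn t = 1.
Proof. exact: sgn_sq. Qed.

Lemma tsgn_pred_pos t : 0 < t -> tsgn (t - 1) = tsgn t.
Proof.
move=> t0; rewrite /tsgn t0; case: ifP => // t1.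
by rewrite (_ : t - 1 = 0); last lia.
Qed.

(** This change of sign cancels the minus sign of [b_plus], so that the main term of [beta] matches
    the positive coefficient sign convention of [pi], namely [q ^+ s]. *)
Lemma tsgn_pred_npos t : t <= 0 -> tsgn (t - 1) = - tsgn t.
Proof.
move=> t0; rewrite /tsgn !ifF; try by apply/negbTE; rewrite -leNgt; lia.
by rewrite (_ : absz (t - 1) = (absz t).+1) ?exprS ?mulN1r//; lia.
Qed.

Lemma U_idx r s t : U (eGam R (r + s + absz t) (kidx s t) (lidx s t)) =
  tsgn t *: delta R (r, (s, t)).
Proof.
rewrite UP; try by rewrite /kidx /lidx; case: (0 < t); lia.
rewrite /tsgn /kidx /lidx.
have [t0|t0] := ltP 0 t; congr (_ ^+ _ *: delta R (_, (_, _))); lia.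
Qed.

Lemma badjU_delta r s t : badj U (delta R (r, (s, t))) =
  tsgn t *: eGam R (r + s + absz t) (kidx s t) (lidx s t).
Proof.
(* The sign squares to 1, so the basis vector is [tsgn t] times an image under [U], which [badj U]
   undoes. *)
rewrite -[LHS]scale1r -(tsgn_sq t) -scalerA -opZ -U_idx.
by rewrite badjU_U.
Qed.

Lemma UbadjU : bcomp U (badj U) = bid R (nat * (nat * int))%type.
Proof.
apply: bop_ext => -[r [s t]].
rewrite -[LHS]/(U (badj U (delta R (r, (s, t))))) badjU_delta opZ U_idx.
by rewrite scalerA tsgn_sq scale1r.
Qed.

End UnitaryU.

Section Differences.
Variables (R : realType) (q : R).
Hypotheses (q_lb : -1 < q) (q_ub : q < 1).
Variables (A : cstarAlgType R) (alpha beta : A).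
Variables (lambda : A -> bop R Gam Gam)
  (pi : A -> bop R (nat * int)%type (nat * int)%type)
  (U : bop R Gam (nat * (nat * int))%type).
Hypotheses (lambdaP : is_lambda q alpha beta lambda) (piP : is_pi q alpha beta pi)
  (UP : is_U U).
Local Notation C := R[i].
Local Notation X := (nat * (nat * int))%type.
Local Notation BK := (tens_alg (@toeplitz R) (@compact_ops R (nat * int)%type)).

Definition lamU (a : A) : bop R X X := bcomp U (bcomp (lambda a) (badj U)).
Definition piI (a : A) : bop R X X := otens (bid R nat) (pi a).

Lemma idx_le r s t : (kidx s t <= r + s + absz t)%N /\ (lidx s t <= r + s + absz t)%N.
Proof. by rewrite /kidx /lidx; case: (0 < t); split; lia. Qed.

Lemma lamU_alpha r s t : lamU alpha (delta R (r, (s, t))) =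
  (symA1 q (r, (s, t)))%:C%C *: delta R (r.+1, (s, t)) +
  (if s is s'.+1 then
    (symA2 q (r, (s, t)) + gq q s)%:C%C *: delta R (r, (s', t)) else 0).
Proof.
rewrite -[LHS]/(U (lambda alpha (badj U (delta R (r, (s, t)))))) badjU_delta//.
have [kl ll] := idx_le r s t; have [_ L] := lambdaP.
rewrite !opZ (L _ _ _ kl ll).1 opD !opZ a_plus_idx.
rewrite a_minus_idx.
rewrite (U_idx UP r.+1) scalerDr !scalerA; congr (_ + _).
  by rewrite mulrAC tsgn_sq mul1r.
(* For [s = 0] the coefficient [symA2 + g 0] vanishes, so the truncated predecessors do no harm. *)
case: s {kl ll} => [|s].
  by rewrite /symA2 gq0 mulr0 mul0r subrr addr0 mulr0 scale0r.
rewrite (_ : (r + s.+1 + absz t).-1 = (r + s + absz t)%N); last lia.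
rewrite (_ : (kidx s.+1 t).-1 = kidx s t); last by rewrite /kidx; case: (0 < t).
rewrite (_ : (lidx s.+1 t).-1 = lidx s t); last by rewrite /lidx; case: (0 < t).
by rewrite U_idx// scalerA mulrAC tsgn_sq mul1r.
Qed.

Lemma lamU_beta_pos r s t : 0 < t -> lamU beta (delta R (r, (s, t))) =
  (symB2 q (r, (s, t)))%:C%C *: delta R (r.+1, (s.+1, t - 1)) +
  (symB1 q (r, (s, t)) + q ^+ s)%:C%C *: delta R (r, (s, t - 1)).
Proof.
move=> t0.
rewrite -[LHS]/(U (lambda beta (badj U (delta R (r, (s, t)))))) badjU_delta//.
have [kl ll] := idx_le r s t; have [_ L] := lambdaP.
rewrite !opZ (L _ _ _ kl ll).2 opD !opZ b_plus_idx_pos// b_minus_idx_pos//.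
(* If [t = 1] then [t - 1 = 0] falls into the other branch of [kidx] and [lidx]; the two branches
   agree there. *)
have k1 : (kidx s t).+1 = kidx s.+1 (t - 1).
  by rewrite /kidx t0; case: ifP => //; lia.
have l0 : lidx s t = lidx s.+1 (t - 1).
  by rewrite /lidx t0; case: ifP => //; lia.
have k0 : kidx s t = kidx s (t - 1) by rewrite /kidx t0; case: ifP => //; lia.
have l1 : (lidx s t).-1 = lidx s (t - 1).
  by rewrite /lidx t0; case: ifP => //; lia.
rewrite l1 k1 {1}l0 k0.
rewrite (_ : (r + s + absz t).+1 = (r.+1 + s.+1 + absz (t - 1))%N); last lia.
rewrite (_ : (r + s + absz t).-1 = (r + s + absz (t - 1))%N); last lia.
rewrite !U_idx// tsgn_pred_pos// scalerDr !scalerA.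
by rewrite !(mulrC _ (tsgn _ t)) !mulrA tsgn_sq !mul1r.
Qed.

Lemma lamU_beta_npos r s t : t <= 0 -> lamU beta (delta R (r, (s, t))) =
  (symB1 q (r, (s, t)) + q ^+ s)%:C%C *: delta R (r, (s, t - 1)) +
  (if (r, s) is (r'.+1, s'.+1) then
    (symB3 q (r, (s, t)))%:C%C *: delta R (r', (s', t - 1)) else 0).
Proof.
move=> t0.
rewrite -[LHS]/(U (lambda beta (badj U (delta R (r, (s, t)))))) badjU_delta//.
have [kl ll] := idx_le r s t; have [_ L] := lambdaP.
rewrite !opZ (L _ _ _ kl ll).2 opD !opZ.
(* Both coefficients become opposites of symbols, ready to cancel the sign in
   [tsgn (t - 1) = - tsgn t]. *)
rewrite -[b_plus _ _ _ _]opprK -[b_minus _ _ _ _]opprK.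
rewrite b_plus_idx_npos// b_minus_idx_npos// !rmorphN/=.
have tF : (0 < t) = false by apply/negbTE; rewrite -leNgt.
have tF' : (0 < t - 1) = false by apply/negbTE; rewrite -leNgt; lia.
have k1 : (kidx s t).+1 = kidx s (t - 1) by rewrite /kidx tF tF'; lia.
have l0 : lidx s t = lidx s (t - 1) by rewrite /lidx tF tF'.
rewrite k1 {1}l0.
rewrite (_ : (r + s + absz t).+1 = (r + s + absz (t - 1))%N); last lia.
rewrite U_idx// tsgn_pred_npos// scalerDr !scalerA; congr (_ + _).
  by rewrite !mulrN mulNr opprK mulrAC tsgn_sq mul1r.
(* The factors [g s] and [g r] of [symB3] remove the term when [s] or [r] cannot be lowered. *)
case: s {kl ll k1 l0} => [|s].
  rewrite /symB3 tF gq0 mul0r mulr0 mul0r oppr0 mulr0 scale0r.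
  by case: r.
case: r => [|r].
  by rewrite /symB3 tF gq0 mulr0 mulr0 mul0r oppr0 mulr0 scale0r.
rewrite (_ : (r.+1 + s.+1 + absz t).-1 = (r + s + absz (t - 1))%N); last lia.
rewrite (_ : kidx s.+1 t = kidx s (t - 1)); last by rewrite /kidx tF tF'; lia.
rewrite (_ : (lidx s.+1 t).-1 = lidx s (t - 1)); last by rewrite /lidx tF tF'; lia.
rewrite U_idx// tsgn_pred_npos// scalerA mulrN mulrN mulNr opprK.
by rewrite mulrAC tsgn_sq mul1r.
Qed.

Lemma pred_int_inj : injective (fun t : int => t - 1).
Proof. exact: addIr. Qed.

Definition zshift : bop R int int := push R pred_int_inj.

(** Here [S] raises the index: the left shift occurring in [pi alpha] is [badj S]. In contrast,
    [zshift] lowers [t]. *)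
Local Notation S := (nshift R).

Lemma real_complexD (x y : R) : (x + y)%:C%C = x%:C%C + y%:C%C.
Proof. exact: rmorphD. Qed.

Lemma lamU_piI_alpha : BK (lamU alpha - piI alpha).
Proof.
have [D1 K1 E1] := tens_alg_diag_sym q_lb q_ub (symA1_le q_lb q_ub)
  (symA1_cvg q_lb q_ub).
have [D2 K2 E2] := tens_alg_diag_sym q_lb q_ub (symA2_le q_lb q_ub)
  (symA2_cvg q_lb q_ub).
(* The first summand raises [r], the second lowers [s]. In each, the factor on the first variable is
   Toeplitz, so [BK] absorbs the product. *)
rewrite (_ : _ - _ = otens S 1 * D1 + otens 1 (otens (badj S) 1) * D2).
  apply: (op_subspaceD (@tens_alg_subspace _ _ _ _)).
    by apply: tens_alg_otensl => //; [exact: toeplitz_cstar|exact: nshift_toeplitz].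
  by apply: tens_alg_otensl => //; [exact: toeplitz_cstar|exact: toeplitz1].
apply: bop_ext => -[r [s t]].
rewrite opBE lamU_alpha /piI otens_delta (piP.2 s t).1 opDE !mulbE E1 E2 !opZ.
rewrite !otens_delta nshift_delta !oneE -delta_pair -addrA; congr (_ + _).
case: s => [|s].
  by rewrite badj_nshift_delta0 !(tens0l, tens0r) scaler0 subrr.
rewrite badj_nshift_delta tensZr -!delta_pair -scalerBl.
by rewrite real_complexD addrK.
Qed.

Lemma lamU_piI_beta : BK (lamU beta - piI beta).
Proof.
have [D1 K1 E1] := tens_alg_diag_sym q_lb q_ub (symB1_le q_lb q_ub)
  (symB1_cvg q_lb q_ub).
have [D2 K2 E2] := tens_alg_diag_sym q_lb q_ub (symB2_le q_lb q_ub)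
  (symB2_cvg q_lb q_ub).
have [D3 K3 E3] := tens_alg_diag_sym q_lb q_ub (symB3_le q_lb q_ub)
  (symB3_cvg q_lb q_ub).
(* [symB2] vanishes for [t <= 0] and [symB3] for [t > 0], so one formula covers both signs of [t];
   [badj S] kills the third term where [r] or [s] is 0. *)
rewrite (_ : _ - _ = otens 1 (otens 1 zshift) * D1 +
   otens S (otens S zshift) * D2 + otens (badj S) (otens (badj S) zshift) * D3).
  have subBK := @tens_alg_subspace R nat (nat * int)%type (@toeplitz R).
  apply: (op_subspaceD subBK); first apply: (op_subspaceD subBK).
  - by apply: tens_alg_otensl => //; [exact: toeplitz_cstar|exact: toeplitz1].
  - by apply: tens_alg_otensl => //; [exact: toeplitz_cstar|exact: nshift_toeplitz].
  - apply: tens_alg_otensl => //; first exact: toeplitz_cstar.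
    by apply: toeplitz_adj; exact: nshift_toeplitz.
apply: bop_ext => -[r [s t]].
rewrite opBE /piI otens_delta (piP.2 s t).2 !opDE !mulbE E1 E2 E3 !opZ.
rewrite !otens_delta nshift_delta !oneE nshift_delta push_delta tensZr -!delta_pair.
have [t0|t0] := ltP 0 t.
  have -> : symB3 q (r, (s, t)) = 0 by rewrite /symB3 t0.
  rewrite lamU_beta_pos// scale0r addr0.
  by rewrite real_complexD scalerDl addrA addrK addrC.
have -> : symB2 q (r, (s, t)) = 0 by rewrite /symB2 ltNge t0.
rewrite lamU_beta_npos// scale0r addr0.
rewrite real_complexD scalerDl addrAC addrK; congr (_ + _).
case: r s => [|r] [|s];
  by rewrite ?badj_nshift_delta0 ?badj_nshift_delta ?(tens0l, tens0r) ?scaler0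
    -?delta_pair.
Qed.

End Differences.

(** * Co-representations *)

Section Representations.
Variables (R : realType) (A : cstarAlgType R).
Local Notation C := R[i].

Section Morphism.
Variables (X : choiceType) (rho : A -> bop R X X).
Hypothesis rhoP : is_rep rho.

Lemma rep0 : rho 0 = 0.
Proof.
have [L _ _ _ _] := rhoP; apply: (addrI (rho 0)).
by rewrite -{1}(scale1r (rho 0)) -L scaler0 !addr0.
Qed.

Lemma repD a b : rho (a + b) = rho a + rho b.
Proof. by have [L _ _ _ _] := rhoP; rewrite -(scale1r a) L !scale1r. Qed.

Lemma repZ c a : rho (c *: a) = c *: rho a.
Proof.
by have [L _ _ _ _] := rhoP; rewrite -[c *: a]addr0 L rep0 addr0.
Qed.

Lemma repB a b : rho (a - b) = rho a - rho b.
Proof. by rewrite repD -scaleN1r repZ scaleN1r. Qed.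

Lemma rep_sum (I : Type) (r : seq I) P (F : I -> A) :
  rho (\sum_(i <- r | P i) F i) = \sum_(i <- r | P i) rho (F i).
Proof. by apply: (big_morph rho repD rep0). Qed.

Lemma map_mx_rep_mul m n p (a : 'M[A]_(m, n)) (b : 'M[A]_(n, p)) :
  map_mx rho (a *m b) = map_mx rho a *m map_mx rho b.
Proof.
have [_ M _ _ _] := rhoP.
apply/matrixP => i j; rewrite !mxE rep_sum; apply: eq_bigr => k _.
by rewrite !mxE M.
Qed.

Lemma map_mx_rep_unitary n (u : 'M[A]_n) :
  unitary_mx (@star R A) u -> unitary_mx (@badj R X X) (map_mx rho u).
Proof.
have [_ _ r1 S _] := rhoP; rewrite /unitary_mx.
have -> : adjmx (@badj R X X) (map_mx rho u) = map_mx rho (adjmx (@star R A) u).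
  by apply/matrixP => i j; rewrite !mxE S.
have e1 : map_mx rho 1%:M = 1%:M :> 'M_n.
  by apply/matrixP => i j; rewrite !mxE; case: (i == j); rewrite ?r1 ?rep0.
by move=> [u1 u2]; split; rewrite -map_mx_rep_mul ?u1 ?u2 e1.
Qed.

Lemma w_of_corep (G : choiceType) (d : G -> nat) (u : forall c, 'M[A]_(d c))
    (D : hat_cop R d) :
  (forall c, unitary_mx (@star R A) (u c)) -> is_dual_cop u D ->
  unitary_corep D (w_of u rho).
Proof.
have [_ M _ _ _] := rhoP.
move=> uu uD; split=> [c|c1 c2 i j k l]; first exact: map_mx_rep_unitary.
rewrite !mxE -M -uD /cop_id rep_sum; apply: eq_bigr => e _.
rewrite rep_sum; apply: eq_bigr => a _; rewrite rep_sum; apply: eq_bigr => b _.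
by rewrite repZ mxE.
Qed.

End Morphism.

Variables (alpha beta : A).
Hypothesis gen : generates alpha beta.

(** With [d = rho1 - rho2], products obey [d(ab) = d(a) d(b) + d(a) rho2(b) + rho2(a) d(b)], so
    absorbing [rho2] is enough to make the set of good [a] an algebra. *)
Lemma rep_diff_generates (X : choiceType) (rho1 rho2 : A -> bop R X X)
    (W : set (bop R X X)) :
  is_rep rho1 -> is_rep rho2 -> op_subspace W -> op_closed W ->
  (forall T, W T -> W (badj T)) ->
  (forall S T, W S -> W T -> W (S * T)) ->
  (forall a T, W T -> W (rho2 a * T)) ->
  (forall a T, W T -> W (T * rho2 a)) ->
  W (rho1 alpha - rho2 alpha) -> W (rho1 beta - rho2 beta) ->
  forall a, W (rho1 a - rho2 a).
Proof.
move=> r1 r2 sW cW aW mW lW rW Wa Wb.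
have [L1 M1 I1 S1 B1] := r1; have [L2 M2 I2 S2 B2] := r2.
apply: (gen (V := [set a | W (rho1 a - rho2 a)])) => //=.
- by rewrite I1 I2 subrr; exact: op_subspace0.
- move=> c a b Va Vb; rewrite L1 L2 opprD addrACA -scalerBr.
  by apply: (op_subspaceD sW) => //; exact: op_subspaceZ.
- move=> a b Va Vb; rewrite M1 M2.
  rewrite (_ : _ - _ = (rho1 a - rho2 a) * (rho1 b - rho2 b)
    + (rho1 a - rho2 a) * rho2 b + rho2 a * (rho1 b - rho2 b)).
    apply: (op_subspaceD sW); last exact: lW.
    by apply: (op_subspaceD sW); [exact: mW|exact: rW].
  by rewrite -mulrDr subrK mulrBl mulrBr addrA subrK.
- by move=> a Va; rewrite S1 S2 -badjB; exact: aW.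
- move=> a Ha; apply: cW => e e0.
  (* Both representations are contractive, so each contributes at most [e / 2]. *)
  have e2 : 0 < e / 2 by rewrite divr_gt0.
  have [b Vb ab] := Ha _ e2; exists (rho1 b - rho2 b) => //.
  have -> : rho1 a - rho2 a - (rho1 b - rho2 b) = rho1 (a - b) - rho2 (a - b).
    by rewrite !repB// !opprB addrACA [RHS]addrACA; congr (_ + _); rewrite addrC.
  rewrite [e]splitr; apply: op_leD; first exact: op_leW (B1 _).
  by apply: op_leN; exact: op_leW (B2 _).
Qed.

End Representations.

(** * Norm estimates for matrices of operators and families *)

Section Families.
Variables (R : realType) (X : choiceType).
Local Notation C := R[i].
Local Notation bop := (bop R).
Local Notation ell2 := (ell2 R).

Lemma inner_suml (I : Type) (r : seq I) (F : I -> ell2 X) h :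
  inner (\sum_(i <- r) F i) h = \sum_(i <- r) inner (F i) h.
Proof.
by apply: (big_morph (fun f => inner f h)) => [f g|]; [exact: innerDl|exact: inner0l].
Qed.

Lemma inner_sumr (I : Type) (r : seq I) (F : I -> ell2 X) h :
  inner h (\sum_(i <- r) F i) = \sum_(i <- r) inner h (F i).
Proof.
by apply: (big_morph (inner h)) => [f g|]; [exact: innerDr|exact: inner0r].
Qed.

Lemma mx_le_unitary n (w : 'M[bop X X]_n) :
  unitary_mx (@badj R X X) w -> mx_le w 1.
Proof.
move=> [ww _] f; rewrite expr1n mul1r.
under eq_bigr do rewrite nrm_sq.
under [leRHS]eq_bigr do rewrite nrm_sq.
rewrite -!(raddf_sum (@complex.Re R)) le_eqVlt; apply/orP; left; apply/eqP.
congr complex.Re; pose g i := \sum_j w i j (f j).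
(* Moving one copy of [w] across the inner product produces [adjmx w *m w], which is the identity:
   [w] is isometric. *)
transitivity (\sum_k inner (\sum_i badj (w i k) (g i)) (f k)).
  under [RHS]eq_bigr do rewrite inner_suml.
  rewrite exchange_big; apply: eq_bigr => i _.
  rewrite -[LHS]/(inner (g i) (\sum_j w i j (f j))) inner_sumr.
  by apply: eq_bigr => k _; exact: esym (opadjP' (w i k) (g i) (f k)).
apply: eq_bigr => k _.
suff -> : \sum_i badj (w i k) (g i) = f k by [].
rewrite /g.
under eq_bigr do rewrite op_sum.
rewrite exchange_big /=.
transitivity (\sum_j (adjmx (@badj R X X) w *m w) k j (f j)).
  apply: eq_bigr => j _; rewrite !mxE sum_opE; apply: eq_bigr => i _.
  by rewrite !mxE.
rewrite ww (bigD1 k)//= big1 => [|j jk]; first by rewrite mxE eqxx addr0.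
by rewrite mxE eq_sym (negbTE jk).
Qed.

Lemma mx_le_mul n (w x : 'M[bop X X]_n) M N :
  mx_le w M -> mx_le x N -> mx_le (w *m x) (M * N).
Proof.
move=> wM xN f; pose h k := \sum_j x k j (f j).
have -> : \sum_i nrm (\sum_j (w *m x) i j (f j)) ^+ 2 =
    \sum_i nrm (\sum_k w i k (h k)) ^+ 2.
  apply: eq_bigr => i _; congr (nrm _ ^+ 2).
  under [RHS]eq_bigr do rewrite op_sum.
  rewrite exchange_big; apply: eq_bigr => j _.
  by rewrite mxE sum_opE.
apply: (le_trans (wM h)); rewrite exprMn -(mulrA (M ^+ 2)).
by apply: ler_wpM2l; [exact: sqr_ge0|exact: xN].
Qed.

(** From [(p + r)^2 <= 2 p^2 + 2 r^2] in each row; summing gives the constant [4 M^2 = (2 M)^2]. *)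
Lemma mx_leB n (w x : 'M[bop X X]_n) M :
  mx_le w M -> mx_le x M -> mx_le (w - x) (2 * M).
Proof.
move=> wM xM f.
apply: (@le_trans _ _ (\sum_i (2 * (nrm (\sum_j w i j (f j)) ^+ 2) +
   2 * nrm (\sum_j x i j (f j)) ^+ 2))).
  apply: ler_sum => i _.
  have -> : \sum_j (w - x) i j (f j) =
      \sum_j w i j (f j) - \sum_j x i j (f j).
    by rewrite -sumrB; apply: eq_bigr => j _; rewrite !mxE opBE.
  have := nrmD (\sum_j w i j (f j)) (- \sum_j x i j (f j)); rewrite nrmN.
  set p := nrm (\sum_j w i j (f j)); set r := nrm (\sum_j x i j (f j)).
  set z := nrm _ => zpr.
  have z0 : 0 <= z := nrm_ge0 _.
  apply: (@le_trans _ _ ((p + r) ^+ 2)).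
    by rewrite ler_pXn2r ?nnegrE// (le_trans z0).
  by have := sqr_ge0 (p - r); nra.
rewrite big_split /= -!mulr_sumr.
have := wM f; have := xM f; rewrite exprMn.
set S := \sum_i _ ^+ 2; nra.
Qed.

Lemma rsum_sum (I : Type) (r : seq I) (F : I -> X -> R) :
  (forall i, summ (F i)) ->
  summ (fun x => \sum_(i <- r) F i x) /\
  rsum (fun x => \sum_(i <- r) F i x) = \sum_(i <- r) rsum (F i).
Proof.
move=> sF; elim: r => [|i r [IH1 IH2]].
  rewrite big_nil (_ : (fun x => _) = fun=> 0) ?rsum0; last first.
    by apply/funext => x; rewrite big_nil.
  split=> //; rewrite /summ /esumR esum1 ?ltry// => x _.
  by rewrite normr0.
rewrite big_cons -IH2 -rsumD// (_ : (fun x => _) =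
    fun x => F i x + \sum_(j <- r) F j x).
  by split=> //; exact: summD.
by apply/funext => x; rewrite big_cons.
Qed.

Lemma nrm_sq_rsum (f : ell2 X) : nrm f ^+ 2 = rsum (fun x => normsq (f x)).
Proof.
by rewrite nrm_sq innerff rsum_ge0E// => x; exact: normsq_ge0.
Qed.

Lemma le_rsum (f h : X -> R) : (forall x, 0 <= f x) ->
  (forall x, f x <= h x) -> summ h -> rsum f <= rsum h.
Proof.
move=> f0 fh sh; have h0 x : 0 <= h x by exact: le_trans (fh x).
have S1 := (summ_ge0 h0).1 sh.
have S0 : (esumR f < +oo)%E by apply: le_lt_trans S1; exact: le_esumR.
rewrite !rsum_ge0E//; apply: fine_le; [exact: fin_esumR|exact: fin_esumR|].
exact: le_esumR.
Qed.

Lemma ell2_sumE (I : Type) (r : seq I) (F : I -> ell2 X) x :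
  (\sum_(i <- r) F i) x = \sum_(i <- r) F i x.
Proof. by apply: (big_morph (fun f : ell2 X => f x)). Qed.

(** A scalar matrix acts separately at each coordinate [x], so the scalar inequality is summed over
    [x]. *)
Lemma mx_le_scalar n (a : 'M[C]_n) M : mxC_le a M ->
  mx_le (map_mx (fun z : C => z *: bid R X) a) M.
Proof.
move=> aM f; pose h i : ell2 X := \sum_j a i j *: f j.
have -> : \sum_i nrm (\sum_j map_mx (fun z : C => z *: bid R X) a i j (f j)) ^+ 2
    = \sum_i nrm (h i) ^+ 2.
  apply: eq_bigr => i _; congr (nrm _ ^+ 2); apply: eq_bigr => j _.
  by rewrite mxE.
under eq_bigr do rewrite nrm_sq_rsum.
under [in leRHS]eq_bigr do rewrite nrm_sq_rsum.
have [_ <-] := rsum_sum (index_enum _) (fun i => ell2P (h i)).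
have [sf <-] := rsum_sum (index_enum _) (fun i => ell2P (f i)).
rewrite -rsumZ//; apply: le_rsum => [x|x|].
- by apply: sumr_ge0 => i _; exact: normsq_ge0.
- have := aM (fun i => f i x); congr (_ <= _); apply: eq_bigr => i _.
  by congr normsq; rewrite ell2_sumE.
- exact: summZ.
Qed.

Variables (G : choiceType) (d : G -> nat).

Lemma hat_tens_mul (B : set (bop X X)) (w x : fam R d X) M : 0 < M ->
  (forall c, mx_le (w c) M) -> hat_tens B x ->
  (forall c i j, B ((w c *m x c) i j)) -> hat_tens B (fun c => w c *m x c).
Proof.
move=> M0 wM [_ xe] Bwx; split=> // e e0.
have [s Hs] := xe _ (divr_gt0 e0 M0); exists s => c cs.
have -> : e = M * (e / M) by rewrite mulrC divfK ?gt_eqF.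
exact: mx_le_mul (wM c) (Hs c cs).
Qed.

Lemma hat_tens_mulr (B : set (bop X X)) (w x : fam R d X) M : 0 < M ->
  (forall c, mx_le (w c) M) -> hat_tens B x ->
  (forall c i j, B ((x c *m w c) i j)) -> hat_tens B (fun c => x c *m w c).
Proof.
move=> M0 wM [_ xe] Bwx; split=> // e e0.
have [s Hs] := xe _ (divr_gt0 e0 M0); exists s => c cs.
have -> : e = (e / M) * M by rewrite divfK ?gt_eqF.
exact: mx_le_mul (Hs c cs) (wM c).
Qed.

Lemma hat_mult_entries (B : set (bop X X)) (w : fam R d X) : op_subspace B ->
  (forall c, mx_le (w c) 1) ->
  (forall c i j T, B T -> B (w c i j * T) /\ B (T * w c i j)) ->
  hat_mult B w.
Proof.
move=> sB w1 wB; split; first by exists 1.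
move=> x xB; have [Bx _] := xB; split.
  apply: (@hat_tens_mul _ _ _ 1) => // c i j; rewrite mxE.
  by apply: (op_subspace_sum sB) => k _; exact: (wB _ _ _ _ (Bx _ _ _)).1.
apply: (@hat_tens_mulr _ _ _ 1) => // c i j; rewrite mxE.
by apply: (op_subspace_sum sB) => k _; exact: (wB _ _ _ _ (Bx _ _ _)).2.
Qed.

(** The decay at infinity comes from [a]; the family [w] contributes its uniform bound and its
    entries in [B]. *)
Lemma hat_local_entries (B : set (bop X X)) (w : fam R d X) M :
  op_subspace B -> 0 < M -> (forall c, mx_le (w c) M) ->
  (forall c i j, B (w c i j)) -> hat_local B w.
Proof.
move=> sB M0 wM Bw; split; first by exists M.
move=> a ha a1.
have a1e e : 0 < e -> exists s : seq G, forall c, c \notin s -> mx_le (a1 c) e.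
  by move=> /ha [s Hs]; exists s => c cs; exact/mx_le_scalar/Hs.
split; split=> [c i j|e e0].
- rewrite mxE; apply: (op_subspace_sum sB) => k _.
  by rewrite mxE scalebAl mul1r; exact: op_subspaceZ.
- have [s Hs] := a1e _ (divr_gt0 e0 M0); exists s => c cs.
  have -> : e = (e / M) * M by rewrite divfK ?gt_eqF.
  exact: mx_le_mul (Hs c cs) (wM c).
- rewrite mxE; apply: (op_subspace_sum sB) => k _.
  by rewrite mxE scalebAr mulr1; exact: op_subspaceZ.
- have [s Hs] := a1e _ (divr_gt0 e0 M0); exists s => c cs.
  have -> : e = M * (e / M) by rewrite mulrC divfK ?gt_eqF.
  exact: mx_le_mul (wM c) (Hs c cs).
Qed.

End Families.

Lemma fredholm_bid (R : realType) (X : choiceType) : fredholm (bid R X).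
Proof.
split; exists 0%N, (fun=> 0) => v.
  by move=> v0; exists (fun=> 0); rewrite big_ord0.
by exists v, (fun=> 0); rewrite big_ord0 addr0.
Qed.

(** * [U lambda U^*] and [1 (x) pi] as representations *)

Section ConjugateRepresentations.
Variables (R : realType) (A : cstarAlgType R).

Lemma lamU_rep (lambda : A -> bop R Gam Gam)
    (U : bop R Gam (nat * (nat * int))%type) :
  is_rep lambda -> is_U U -> is_rep (lamU lambda U).
Proof.
move=> [L M I S B] UP.
(* [U^*U = 1] gives multiplicativity, [UU^* = 1] gives the unit, and together they preserve norms in
   both directions. *)
have K f : opadj U (U f) = f := badjU_U UP f.
have K' f : U (opadj U f) = f by rewrite -[RHS]/(bid R _ f) -(UbadjU UP).
have nU f : nrm (U f) = nrm f by rewrite /nrm opadjP K.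
have nU' f : nrm (opadj U f) = nrm f by rewrite -nU K'.
split.
- by move=> c a b; apply: bop_eq => f; rewrite /= L opD opZ.
- by move=> a b; apply: bop_eq => f; rewrite /= M K.
- by apply: bop_eq => f; rewrite /= I K'.
- by move=> a; apply: bop_eq => f; rewrite /= S.
- by move=> a f; rewrite /= nU; apply: le_trans (B _ _) _; rewrite nU'.
Qed.

Lemma piI_rep (pi : A -> bop R (nat * int)%type (nat * int)%type) :
  is_rep pi -> is_rep (piI pi).
Proof.
move=> [L M I S B]; split.
- move=> c a b; apply: bop_ext => -[x y].
  by rewrite /piI opDE opZE !otens_delta L opDE opZE tensDr tensZr.
- by move=> a b; rewrite /piI otensM M; congr otens; exact: bop_eq.
- by rewrite /piI I; exact: otens1.
- by move=> a; rewrite /piI badj_otens S; congr otens; exact: bop_eq.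
- move=> a; rewrite /piI otens_bid; apply: amp_op_le => //.
  (* Nonnegativity of [cnorm a] is read off from the action of [pi a] on a unit vector. *)
  rewrite -[cnorm a]mulr1 -(nrm_delta R (0%N, 0 : int)).
  exact: le_trans (nrm_ge0 _) (B _ _).
Qed.

End ConjugateRepresentations.

Theorem mainTheorem4 (R : realType) (q : R) (q_lb : -1 < q) (q_ub : q < 1)
    (q_neq0 : q != 0)
    (A : cstarAlgType R) (alpha beta : A) (A_SUq2 : is_CSUq2 q alpha beta)
    (G : choiceType) (d : G -> nat) (u : forall c : G, 'M[A]_(d c))
    (u_irr : irr_family q alpha beta u)
    (D : hat_cop R d) (D_cop : is_dual_cop u D)
    (lambda : A -> bop R Gam Gam) (lambdaP : is_lambda q alpha beta lambda)
    (pi : A -> bop R (nat * int)%type (nat * int)%type)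
    (piP : is_pi q alpha beta pi)
    (U : bop R Gam (nat * (nat * int))%type) (UP : is_U U) :
  let w_lambda := w_of u (fun a => bcomp U (bcomp (lambda a) (badj U))) in
  let w_pi := w_of u (fun a => otens (bid R nat) (pi a)) in
  hat_local (tens_alg (@toeplitz R) (@compact_ops R (nat * int)%type))
    (fun c : G => w_lambda c - w_pi c) /\
  fredholm_rep D (@toeplitz R) w_lambda w_pi (bid R (nat * (nat * int))%type).
Proof.
move=> w_lambda w_pi; set BK := tens_alg _ _.
have sBK : op_subspace BK := @tens_alg_subspace _ _ _ _.
have Tc := @toeplitz_cstar R.
have lamR : is_rep (lamU lambda U) := lamU_rep lambdaP.1 UP.
have piR : is_rep (piI pi) := piI_rep piP.1.
have piBK a T : BK T -> BK (piI pi a * T) by exact: tens_alg_ampl.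
have BKpi a T : BK T -> BK (T * piI pi a) by exact: tens_alg_ampr.
have diff a : BK (lamU lambda U a - piI pi a).
  have [_ gen _] := A_SUq2.
  apply: (rep_diff_generates gen lamR piR sBK) => //.
  - exact: tens_alg_closed.
  - by move=> T; exact: tens_alg_adj.
  - by move=> S T; exact: tens_algM.
  - exact: lamU_piI_alpha lambdaP piP UP.
  - exact: lamU_piI_beta lambdaP piP UP.
(* Writing [lamU] as the difference plus [piI] transfers absorption from [piI] to [lamU]. *)
have lamBK a T : BK T -> BK (lamU lambda U a * T).
  move=> KT; rewrite -[lamU lambda U a](subrK (piI pi a)) mulrDl.
  by apply: (op_subspaceD sBK); [exact: (tens_algM Tc (diff a))|exact: piBK].
have BKlam a T : BK T -> BK (T * lamU lambda U a).
  move=> KT; rewrite -[lamU lambda U a](subrK (piI pi a)) mulrDr.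
  by apply: (op_subspaceD sBK); [exact: (tens_algM Tc KT (diff a))|exact: BKpi].
have uu c : unitary_mx (@star R A) (u c) by have [/(_ c)[[]]] := u_irr.
have lamC : unitary_corep D w_lambda := w_of_corep lamR uu D_cop.
have piC : unitary_corep D w_pi := w_of_corep piR uu D_cop.
have lam1 c : mx_le (w_lambda c) 1 := mx_le_unitary (lamC.1 c).
have pi1 c : mx_le (w_pi c) 1 := mx_le_unitary (piC.1 c).
have loc : hat_local BK (fun c : G => w_lambda c - w_pi c).
  (* The bound is that of a difference of two unitaries, uniform in [c]. *)
  apply: (@hat_local_entries _ _ _ _ _ _ (2 * 1)) => // c.
    exact: (mx_leB (lam1 c) (pi1 c)).
  by move=> i j; rewrite !mxE; exact: diff.
split; first exact: loc.
split; [exact: Tc|exact: fredholm_bid|by split| |].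
- split; apply: (hat_mult_entries sBK) => [c|c i j T KT].
  + exact: lam1.
  + by rewrite mxE; split; [exact: lamBK|exact: BKlam].
  + exact: pi1.
  + by rewrite mxE; split; [exact: piBK|exact: BKpi].
- rewrite (_ : (fun c => _) = (fun c => w_lambda c - w_pi c)); first exact: loc.
  apply: functional_extensionality_dep => c; apply/matrixP => i j.
  by rewrite !mxE mul1r mulr1.
Qed.
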